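(* If $(W,S)$ is a finite irreducible Coxeter system with Coxeter number $h$ and $k>0$ is an integer, then \[\operatorname{SC}_k(W)\,=\,\frac{h}{2}\,\sum_{s\in S}\operatorname{SC}_{k-1}(W_{\langle s\rangle}).\]
   Context: Let $(W,S)$ be a finite Coxeter system of rank $n=|S|$ and let $T$ be the set of reflections of $W$ (all conjugates of elements of $S$). The absolute length $\ell_T(w)$ of $w\in W$ is the minimal length of a word in the alphabet $T$ representing $w$; a word in $T$ for $w$ of this minimal length is a reduced $T$-word for $w$. The absolute order on $W$ sets $u\le v$ if and only if $u$ has a reduced $T$-word which is a prefix of some reduced $T$-word for $v$. A Coxeter element is $c=s_1s_2\cdots s_n$ with each element of $S$ occurring exactly once. The noncrossing partition lattice $L_W$ is the interval $[1,c]$ in the absolute order; its isomorphism type does not depend on the choice of $c$, and it is graded of rank $n$ with rank function $\ell_T$. The Coxeter number $h$ of an irreducible $W$ is the order of a Coxeter element. $\operatorname{SC}_k(W)$ is the total number of saturated chains of length $k$ in $L_W$, i.e. sequences $x_0,x_1,\ldots,x_k$ of $k+1$ elements of $L_W$ such that $x_i$ covers $x_{i-1}$ in $L_W$ for each $i=1,\ldots,k$ (with $x_0$ of arbitrary rank). For $s\in S$, $W_{\langle s\rangle}$ denotes the parabolic subgroup of $W$ generated by $S\setminus\{s\}$, regarded as a Coxeter system with simple reflections $S\setminus\{s\}$ (possibly reducible or trivial). *)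

(* Defs.v *)
From mathcomp Require Import all_boot all_fingroup.
From mathcomp Require Import boolp.

Set Implicit Arguments.
Unset Strict Implicit.
Unset Printing Implicit Defensive.

Local Open Scope group_scope.

Section CoxeterSystems.
Variable gT : finGroupType.
Implicit Types (W S : {set gT}) (s t u v w c : gT) (r : seq gT).

(* W = < S | (s t)^m(s,t) = 1 > where m(s,t) is the order of s t; the          *)
(* presentation is expressed by its universal property with respect to all    *)
(* (possibly infinite) groups H.                                              *)
Definition coxeter_system W S : Prop :=
  [/\ <<S>> = W,
      {in S, forall s, #[s] = 2%N}
    & forall (H : groupType) (f : gT -> H),
        {in S &, forall s t, (f s * f t) ^+ #[s * t] = 1} ->
        exists2 phi : gT -> H,
          {in W &, {morph phi : x y / x * y}} & {in S, phi =1 f}].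

Definition coxeter_graph S : rel gT :=
  [rel s t | [&& s \in S, t \in S & (2 < #[s * t])%N]].

Definition coxeter_irreducible S : Prop :=
  S != set0 /\ {in S &, forall s t, connect (coxeter_graph S) s t}.

Definition coxeter_element S c : Prop :=
  exists2 r, perm_eq r (enum S) & c = \prod_(s <- r) s.

Definition coxeter_number S (h : nat) : Prop :=
  exists2 c, coxeter_element S c & h = #[c].

Definition reflections W S : {set gT} := class_support S W.

Definition T_word W S w r : Prop :=
  {subset r <= reflections W S} /\ \prod_(t <- r) t = w.

Definition reduced_T_word W S w r : Prop :=
  T_word W S w r /\ forall r', T_word W S w r' -> (size r <= size r')%N.

Definition abs_le W S u v : Prop :=
  exists r r', [/\ reduced_T_word W S u r, reduced_T_word W S v r'
                 & prefix r r'].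

Definition abs_lt W S u v : Prop := abs_le W S u v /\ u <> v.

Definition noncrossing W S c : {set gT} :=
  [set u | `[< abs_le W S 1 u /\ abs_le W S u c >]].

Definition nc_covers W S c u v : Prop :=
  [/\ u \in noncrossing W S c, v \in noncrossing W S c, abs_lt W S u v
    & forall w, w \in noncrossing W S c ->
        ~ (abs_lt W S u w /\ abs_lt W S w v)].

Definition SC W S c (k : nat) : nat :=
  #|[set x : k.+1.-tuple gT |
      all [in noncrossing W S c] x
      && sorted (fun u v => `[< nc_covers W S c u v >]) x]|.

End CoxeterSystems.

(* Main.v *)
From HB Require Import structures.
Require Import Defs.
From mathcomp Require Import all_boot all_order all_algebra all_fingroup.
From mathcomp Require classical_sets.
From mathcomp Require Import Rstruct cyclic boolp reals trigo.
From mathcomp Require Import ring lra zify.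

Set Implicit Arguments.
Unset Strict Implicit.
Unset Printing Implicit Defensive.
Import Order.TTheory GRing.Theory Num.Theory.

(** Write T for the reflections. A saturated chain x_0 < ... < x_k below c with
    first step t_1 = x_0^-1 x_1 amounts to the reflection t = x_1 x_0^-1 and the
    chain x_0, t x_2, ..., t x_k below tc, so SC_k(W) is the sum over t of the
    number of chains of length k-1 below tc.

    Coxeter elements are conjugate because the Coxeter graph is a forest; take
    c = c_+ c_- bipartite. Let x_l be the product of the first l factors of
    c_+ c_- c_+ ..., so x_2h = 1, and consider the reflections x_l s x_l^-1
    with l < 2h and s of the colour following x_l. Such a reflection times c is
    conjugate to a Coxeter element of W_<s>, so the formula follows once every
    reflection is seen to occur exactly twice. The Perron-Frobenius eigenvector
    of the Cartan matrix is a functional whose values on the roots x_l alpha_s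
    with s of one colour all have the same sign. Hence these roots are all
    positive for l < m and all negative for m <= l < 2h, with all simple roots
    made negative by x_m, and a positive root changes sign exactly once in
    either phase. *)

(** * Saturated chains as products of reflections *)

(** Chains are described by membership in the powers [T ^+ j] alone, with the total word length [N]
    as a parameter. When [N] is the absolute length of [w], factorizations of [w] into [N] letters
    are automatically reduced, so the absolute order is met only in the comparison with [SC]. The
    obstacle is then that the chains below [t^-1 * c] may step through all reflections of [W],
    whereas [SC] of a parabolic subgroup admits only its own. Geometry removes it: in a shortest
    factorization of a parabolic Coxeter element the roots are independent, so each letter fixes
    every vector that the product fixes, and this confines its root to the span of the remaining
    simple roots. The factor h/2 is a ratio of two counts: each generator has the colour following
    exactly h of the 2h levels, while each reflection is met twice. Since the Coxeter system is
    given by a presentation, the reflection representation has to be built first; finiteness of [W]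
    then makes the Cartan matrix positive definite, which yields both the forest and the
    eigenvector. *)

Section SetPowers.
Local Open Scope group_scope.
Variable gT : finGroupType.
Implicit Types (T : {set gT}) (u v w x y t : gT) (r s : seq gT).

Lemma mem_expgP T j w :
  reflect (exists r, [/\ size r = j, {subset r <= T} & \prod_(t <- r) t = w])
          (w \in T ^+ j).
Proof.
elim: j w => [|j IHj] w.
  rewrite expg0 inE; apply: (iffP eqP) => [->|[r [/size0nil-> _ <-]]].
    by exists [::]; rewrite big_nil.
  by rewrite big_nil.
rewrite expgS; apply: (iffP mulsgP) => [[t u Tt /IHj[r [sz_r rT <-]] ->]|].
  exists (t :: r); split; rewrite ?big_cons //= ?sz_r // => z.
  by rewrite inE => /predU1P[->|/rT].
case=> -[[]//|t r] [[sz_r] rT <-]; rewrite big_cons.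
exists t (\prod_(i <- r) i) => //; first exact/rT/mem_head.
by apply/IHj; exists r; split=> // z zr; apply: rT; rewrite inE zr orbT.
Qed.

Lemma mem_expgD T i j u v :
  u \in T ^+ i -> v \in T ^+ j -> u * v \in T ^+ (i + j).
Proof. by move=> Tu Tv; rewrite expgD mem_mulg. Qed.

Lemma mem_expgJ T j w x : (w ^ x \in (T :^ x) ^+ j) = (w \in T ^+ j).
Proof.
suff ->: (T :^ x) ^+ j = T ^+ j :^ x by rewrite memJ_conjg.
by elim: j => [|j IHj]; rewrite ?expg0 ?conjs1g // !expgS conjsMg IHj.
Qed.

Lemma prod_mem_expg T r : {subset r <= T} -> \prod_(t <- r) t \in T ^+ (size r).
Proof. by move=> rT; apply/mem_expgP; exists r. Qed.

(** The number [j] plays the role of the rank of [x], and the last condition leaves exactly the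
    letters needed to reach [w]. No minimality is asked, so the recursion on the first step holds
    for every [w]. *)
Definition chain_in T N w x s : bool :=
  has (fun j => [&& (j + size s <= N)%N, x \in T ^+ j,
                    path (fun u v => u^-1 * v \in T) x s
                  & (last x s)^-1 * w \in T ^+ (N - (j + size s))])
      (iota 0 N.+1).

Lemma chain_inP T N w x s :
  reflect (exists j, [/\ (j + size s <= N)%N, x \in T ^+ j,
                    path (fun u v => u^-1 * v \in T) x s
                  & (last x s)^-1 * w \in T ^+ (N - (j + size s))])
          (chain_in T N w x s).
Proof.
apply: (iffP hasP) => [[j _ /and4P[]]|[j [leN *]]]; first by exists j.
exists j; last exact/and4P.
by rewrite mem_iota /= add0n ltnS (leq_trans _ leN) ?leq_addr.
Qed.

Definition chain_set T N w k : {set k.+1.-tuple gT} :=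
  [set x | chain_in T N w (thead x) (behead x)].

Lemma path_step_mull T t x s :
  path (fun u v => u^-1 * v \in T) (t * x) (map (mulg t) s)
    = path (fun u v => u^-1 * v \in T) x s.
Proof.
elim: s x => //= y s IHs x.
by rewrite IHs invMg mulgA -(mulgA x^-1) mulVg mulg1.
Qed.

Lemma path_step_mem T x s :
  path (fun u v => u^-1 * v \in T) x s -> x^-1 * last x s \in T ^+ (size s).
Proof.
elim: s x => [|y s IHs] x /=; first by rewrite mulVg expg0 inE.
by case/andP=> Txy /IHs; rewrite expgS -{2}(mulKVg y (last y s)) mulgA; apply: mem_mulg.
Qed.

(* Deleting the first step of a chain below w and moving it to the front as t
   leaves a chain below t^-1 w. *)
Lemma chain_in_cons T N w x y s (t := y * x^-1) :
    T :^ x = T ->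
  chain_in T N.+1 w x (y :: s)
    = (t \in T) && chain_in T N (t^-1 * w) x (map (mulg t^-1) s).
Proof.
move=> Tx; have ty: t^-1 * y = x by rewrite /t invMg invgK mulgKV.
have tT: (t \in T) = (x^-1 * y \in T).
  have ->: x^-1 * y = t ^ x by rewrite /conjg /t mulgKV.
  by rewrite -{2}Tx memJ_conjg.
have pE: path (fun u v => u^-1 * v \in T) x (map (mulg t^-1) s)
    = path (fun u v => u^-1 * v \in T) y s by rewrite -{1}ty path_step_mull.
have lE: (last x (map (mulg t^-1) s))^-1 * (t^-1 * w) = (last y s)^-1 * w.
  by rewrite -{1}ty last_map invMg invgK mulgA mulgK.
apply/chain_inP/andP => [[j [leN Tj /= /andP[Txy pth] Tl]]|[]].
  split; first by rewrite tT.
  apply/chain_inP; exists j; rewrite size_map pE lE; split=> //.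
    by rewrite addnS in leN.
  by rewrite addnS subSS in Tl.
rewrite tT => Txy /chain_inP[j]; rewrite size_map pE lE => -[leN Tj pth Tl].
by exists j; rewrite /= Txy addnS subSS.
Qed.

Lemma card_chain_set_rec (G : {group gT}) T N w k :
    T \subset G -> {in G, forall x, T :^ x = T} ->
  #|chain_set T N.+1 w k.+1| = \sum_(t in T) #|chain_set T N (t^-1 * w) k|.
Proof.
move=> sTG Tconj.
have memG x j : x \in T ^+ j -> x \in G.
  case/mem_expgP=> r [_ rT <-]; rewrite big_seq group_prod // => z /rT.
  exact: (subsetP sTG).
have chG M v x s : chain_in T M v x s -> x \in G.
  by case/chain_inP=> j [_ /memG].
(* [psi] restores the deleted step: (t, (x0, y1, ...)) becomes (x0, t x0, t y1, ...). *)
pose psi (p : gT * k.+1.-tuple gT) : k.+2.-tuple gT :=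
  [tuple of thead p.2 :: map (mulg p.1) p.2].
have psi_inj: injective psi.
  move=> [t x] [u y] /(congr1 val)/=; case: (tupleP x) => x0 x'.
  case: (tupleP y) => y0 y' /=; rewrite !theadE => -[-> /mulIg-> /inj_map eq_xy].
  by congr pair; congr cons_tuple; apply/val_inj/eq_xy/mulgI.
transitivity #|psi @: [set p : gT * k.+1.-tuple gT | (p.1 \in T)
                        && (p.2 \in chain_set T N (p.1^-1 * w) k)]|.
  apply: eq_card => x; rewrite inE; apply/idP/imsetP => [|[[t y]]].
    case: (tupleP x) => x0 x'; case: (tupleP x') => x1 {x x'} s.
    rewrite theadE /= => ch; have Gx := chG _ _ _ _ ch.
    rewrite chain_in_cons ?Tconj // in ch.
    exists (x1 * x0^-1, [tuple of x0 :: map (mulg (x1 * x0^-1)^-1) s]).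
      by rewrite !inE /= theadE.
    apply: val_inj; rewrite /= theadE mulgKV; congr [:: _, _ & _].
    by rewrite -map_comp map_id_in // => z _ /=; rewrite mulKVg.
  case: (tupleP y) => x0 {y} s; rewrite !inE /= theadE /= => /andP[Tt ch] ->.
  rewrite theadE /= chain_in_cons ?Tconj ?(chG _ _ _ _ ch) // mulgK Tt /=.
  by rewrite -map_comp map_id_in // => z _ /=; rewrite mulKg.
rewrite card_imset // -sum1_card.
transitivity (\sum_(t in T) \sum_(y in chain_set T N (t^-1 * w) k) 1)%N.
  by rewrite pair_big_dep /=; apply: eq_bigl => p; rewrite inE.
by apply: eq_bigr => t _; rewrite sum1_card.
Qed.

Lemma card_chain_setJ (T : {set gT}) N w k x :
  T :^ x = T -> #|chain_set T N (w ^ x) k| = #|chain_set T N w k|.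
Proof.
move=> Tx; pose psi (y : k.+1.-tuple gT) := [tuple of map (conjg^~ x) y].
have psi_inj: injective psi.
  move=> y z /(congr1 val)/= eq_yz; apply/val_inj/(inj_map _ eq_yz).
  exact: conjg_inj.
rewrite -[RHS](card_imset _ psi_inj); apply: eq_card.
have chJ y s : chain_in T N (w ^ x) (y ^ x) (map (conjg^~ x) s)
    = chain_in T N w y s.
  apply: eq_has => j; rewrite size_map -{1}Tx mem_expgJ (last_map (conjg^~ x)).
  rewrite -conjVg -conjMg -{3}Tx mem_expgJ; congr [&& _, _, _ & _].
  elim: s y => //= z s IHs y; rewrite IHs; congr (_ && _).
  by rewrite -conjVg -conjMg -{1}Tx memJ_conjg.
move=> y; rewrite inE; apply/idP/imsetP => [ch|[z + ->]]; last first.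
  by case: (tupleP z) => z0 z'; rewrite !inE !theadE /= chJ.
have [z eq_y]: exists z, y = psi z.
  exists [tuple of map (conjg^~ x^-1) y]; apply: val_inj.
  by rewrite /= -map_comp map_id_in // => z _ /=; exact: conjgKV.
exists z => //; move: ch; rewrite eq_y.
by case: (tupleP z) => z0 z'; rewrite !inE !theadE /= chJ.
Qed.

(** A chain completes to a word for [w] of length [N]: letters for its first element, then its
    steps, then letters for the remainder. A condition on all such words therefore controls every
    membership that defines the chain. *)
Lemma chain_set_sub_eq (T U : {set gT}) N w k :
    U \subset T ->
    (forall r, size r = N -> {subset r <= T} -> \prod_(t <- r) t = w ->
       {subset r <= U}) ->
  chain_set T N w k = chain_set U N w k.
Proof.
move=> sUT wordU.
have sub1 j v : v \in U ^+ j -> v \in T ^+ j.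
  by case/mem_expgP=> r [? rU ?]; apply/mem_expgP; exists r; split=> // z /rU/(subsetP sUT).
apply/setP=> x; case: (tupleP x) => x0 {x} s; rewrite !inE !theadE /=.
apply/chain_inP/chain_inP => -[j [leN Tx pth Tl]]; last first.
  exists j; split; rewrite ?sub1 //; apply: sub_path pth => u v.
  exact: (subsetP sUT).
exists j; case/mem_expgP: (Tx) => a [sz_a aT def_x].
case/mem_expgP: (Tl) => d [sz_d dT def_d].
pose b := pairmap (fun u v => u^-1 * v) x0 s.
have bT: {subset b <= T}.
  rewrite /b; elim: (val s) (x0) pth => //= y s' IHs z /andP[Tz pth] t.
  by rewrite inE => /predU1P[->|/IHs->].
have prod_b: x0 * \prod_(t <- b) t = last x0 s.
  rewrite /b; elim: (val s) (x0) => [|y s' IHs] z /=; first by rewrite big_nil mulg1.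
  by rewrite big_cons mulgA mulKVg IHs.
have abdU: {subset a ++ b ++ d <= U}.
  apply: wordU.
  - by rewrite !size_cat size_pairmap sz_a sz_d addnA subnKC.
  - by move=> t; rewrite !mem_cat => /or3P[/aT|/bT|/dT].
  - by rewrite !big_cat /= def_x mulgA prod_b def_d mulKVg.
have memU r : {subset r <= a ++ b ++ d} -> \prod_(t <- r) t \in U ^+ (size r).
  by move=> sub_r; apply: prod_mem_expg => t /sub_r/abdU.
split=> //.
- by rewrite -def_x -sz_a; apply: memU => t; rewrite mem_cat => ->.
- have: {subset b <= U} by move=> t bt; apply: abdU; rewrite !mem_cat bt orbT.
  rewrite /b; elim: (val s) (x0) => //= y s' IHs z sU.
  rewrite sU ?mem_head //= IHs // => t s't; apply: sU.
  by rewrite inE s't orbT.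
- rewrite -def_d -sz_d; apply: memU => t dt.
  by rewrite !mem_cat dt !orbT.
Qed.
End SetPowers.

(** * Comparison with the absolute order *)

Section NoncrossingChains.
Local Open Scope group_scope.
Variables (gT : finGroupType) (W S : {set gT}).
Implicit Types (u v w c x y t : gT) (r s : seq gT).
Let T := reflections W S.

Let mlen v i := v \in T ^+ i /\ forall m, v \in T ^+ m -> i <= m.

Let mlen_inj v i j : mlen v i -> mlen v j -> i = j.
Proof. by move=> [vi mi] [vj mj]; apply/eqP; rewrite eqn_leq mi ?mj. Qed.

Let reduced_mlen v r :
  reduced_T_word W S v r <->
  [/\ {subset r <= T}, \prod_(t <- r) t = v & mlen v (size r)].
Proof.
split=> [[[rT vE] minr]|[rT vE [_ minr]]].
  split=> //; split=> [|m /mem_expgP[r' [<- r'T r'v]]]; last exact: minr.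
  by rewrite -vE prod_mem_expg.
by split=> // r' [r'T r'v]; apply: minr; rewrite -r'v prod_mem_expg.
Qed.

(** A shorter word for [u], completed by the word for [u^-1 * v], would be too short for [v]. *)
Let mlen_left u v i j : j <= i -> mlen v i -> u \in T ^+ j ->
  u^-1 * v \in T ^+ (i - j) -> mlen u j.
Proof.
move=> le_ji [_ minv] uj uvj; split=> // m um.
have := mem_expgD um uvj; rewrite mulKVg => /minv; lia.
Qed.

Let abs_leP v i u : mlen v i ->
  abs_le W S u v <-> exists2 j, j <= i & mlen u j /\ u^-1 * v \in T ^+ (i - j).
Proof.
move=> mv; split=> [[r [r' []]]|[j le_ji [mu]]].
  move=> /reduced_mlen[rT uE mu] /reduced_mlen[r'T vE mv'] /prefixP[q def_r'].
  have def_i := mlen_inj mv mv'; rewrite def_r' size_cat in def_i.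
  exists (size r); first by rewrite def_i leq_addr.
  split=> //; rewrite def_i addKn -vE -uE def_r' big_cat /= mulKg.
  by apply: prod_mem_expg => t qt; rewrite r'T // def_r' mem_cat qt orbT.
case: (mu) => /mem_expgP[r [sz_r rT uE] _] /mem_expgP[q [sz_q qT qE]].
exists r, (r ++ q); split; last exact: prefix_prefix.
  by apply/reduced_mlen; rewrite sz_r.
apply/reduced_mlen; rewrite size_cat sz_r sz_q subnKC // big_cat /= qE uE mulKVg.
by split=> // t; rewrite mem_cat => /orP[/rT|/qT].
Qed.

Variables (N : nat) (c : gT).
Hypotheses (cN : c \in T ^+ N) (cmin : forall m, c \in T ^+ m -> N <= m).
Hypothesis T1 : 1 \notin T.

Let ncP u :
  reflect (exists2 j, j <= N & mlen u j /\ u^-1 * c \in T ^+ (N - j))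
          (u \in noncrossing W S c).
Proof.
rewrite inE; apply: (iffP (asboolP _)) => [[_ /abs_leP-/(_ N)]|]; first exact.
move=> ex; split; last exact/abs_leP/ex.
case: ex => j _ [mu _]; apply/(abs_leP _ mu); exists 0%N => //.
by rewrite invg1 mul1g subn0; case: mu; split.
Qed.

Let abs_lt_mlen u v i j : mlen u i -> mlen v j -> abs_lt W S u v -> i < j.
Proof.
move=> mu mv [/(abs_leP _ mv)[i' le_i'j [mu' uv]] neq_uv].
rewrite (mlen_inj mu mu') ltn_neqAle le_i'j andbT.
apply: contra_not_neq neq_uv => def_i'; move: uv; rewrite def_i' subnn expg0.
by move/set1P/(canRL (mulKVg _)); rewrite mulg1.
Qed.

Let coversP u v :
  nc_covers W S c u v <->
  exists j, [/\ j < N, mlen u j, mlen v j.+1, u^-1 * v \in T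
               & v^-1 * c \in T ^+ (N - j.+1)].
Proof.
split=> [[/ncP[i le_iN [mu uc]] /ncP[j le_jN [mv vc]] lt_uv nobetween]|].
  have lt_ij := abs_lt_mlen mu mv lt_uv.
  have [/(abs_leP _ mv)[i' _ [/(mlen_inj mu)<- {i'} uv]] _] := lt_uv.
  case: (ltngtP i.+1 j) lt_ij => // [lt_i1j _ | def_j _]; last first.
    exists i; rewrite -def_j subSnn expg1 in uv *.
    by rewrite def_j.
  (* If the absolute lengths differ by more than one, appending to [u] the first letter of a word
     for [u^-1 * v] gives an element strictly between. *)
  case/mem_expgP: uv => -[|t r]; first by case=> /=; lia.
  case=> /= sz_r tT; rewrite big_cons => uv; pose w := u * t.
  have Tt: t \in T by rewrite tT ?mem_head.
  have wi: w \in T ^+ i.+1 by rewrite -addn1 mem_expgD ?expg1 //; case: mu.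
  have wv: w^-1 * v \in T ^+ (j - i.+1).
    apply/mem_expgP; exists r; split; first lia.
      by move=> z rz; rewrite tT // inE rz orbT.
    by rewrite /w invMg -mulgA -uv mulKg.
  have wc: w^-1 * c \in T ^+ (N - i.+1).
    have ->: (N - i.+1 = (j - i.+1) + (N - j))%N by lia.
    by rewrite -(mulKVg v c) mulgA mem_expgD.
  have mw: mlen w i.+1 by apply: mlen_left wc => //; lia.
  case: (nobetween w); first by apply/ncP; exists i.+1; [lia | ].
  split; split.
  - apply/(abs_leP _ mw); exists i; rewrite // subSnn expg1.
    by rewrite /w mulKg.
  - by move=> def_u; move: mw; rewrite -def_u => /(mlen_inj mu); lia.
  - by apply/(abs_leP _ mv); exists i.+1; [lia | ].
  - by move=> def_w; move: mw; rewrite def_w => /(mlen_inj mv); lia.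
case=> j [lt_jN mu mv Tuv vc].
have uc: u^-1 * c \in T ^+ (N - j).
  have ->: (N - j = 1 + (N - j.+1))%N by lia.
  by rewrite -(mulKVg v c) mulgA mem_expgD ?expg1.
split.
- by apply/ncP; exists j => //; exact: ltnW.
- by apply/ncP; exists j.+1.
- split; last by move=> def_u; rewrite def_u mulVg (negPf T1) in Tuv.
  by apply/(abs_leP _ mv); exists j; rewrite ?subSnn ?expg1.
move=> w /ncP[i _ [mw _]] [lt_uw lt_wv].
by have:= abs_lt_mlen mu mw lt_uw; have:= abs_lt_mlen mw mv lt_wv; lia.
Qed.

Let mlen_first x s j :
    j + size s <= N -> x \in T ^+ j -> path (fun u v => u^-1 * v \in T) x s ->
    (last x s)^-1 * c \in T ^+ (N - (j + size s)) ->
  mlen x j /\ x^-1 * c \in T ^+ (N - j).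
Proof.
move=> leN xj /path_step_mem xs sc.
have xc: x^-1 * c \in T ^+ (N - j).
  have ->: (N - j = size s + (N - (j + size s)))%N by lia.
  by rewrite -(mulKVg (last x s) c) mulgA mem_expgD.
by split=> //; apply: mlen_left xc => //; lia.
Qed.

Let chainsP x s :
  (all [in noncrossing W S c] (x :: s)
     && path (fun u v => `[< nc_covers W S c u v >]) x s)
  = chain_in T N c x s.
Proof.
elim: s x => [|y s IHs] x /=.
  rewrite !andbT; apply/ncP/chain_inP => [[j le_jN [[xj _] xc]]|[j []]].
    by exists j; rewrite addn0.
  rewrite addn0 => le_jN xj _ xc; exists j => //; split=> //.
  exact: mlen_left xc.
have ->: ([&& x \in noncrossing W S c, y \in noncrossing W S c & all [in noncrossing W S c] s]
    && (`[< nc_covers W S c x y >] && path (fun u v => `[< nc_covers W S c u v >]) y s))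
   = [&& x \in noncrossing W S c, `[< nc_covers W S c x y >] & chain_in T N c y s].
  rewrite -IHs /=; do !case: (_ \in _) => //=; rewrite ?andbF //.
  by rewrite andbCA.
apply/and3P/chain_inP => [[_ /asboolP/coversP[j [lt_jN mx my Txy yc]]]|].
  case/chain_inP=> j' [le_N yj' pth Tl].
  have [my' _] := mlen_first le_N yj' pth Tl.
  rewrite (mlen_inj my' my) in le_N Tl; exists j; rewrite /= Txy pth addnS -addSn.
  by split=> //; case: mx.
case=> j [/= leN xj pth Tl]; have [mx xc] := @mlen_first x (y :: s) j leN xj pth Tl.
have /andP[Txy pth'] := pth; rewrite addnS -addSn in leN Tl.
have yj: y \in T ^+ j.+1 by rewrite -addn1 -(mulKVg x y) mem_expgD ?expg1.
have [my yc] := mlen_first leN yj pth' Tl.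
split; first by apply/ncP; exists j => //; lia.
  by apply/asboolP/coversP; exists j; split=> //; lia.
by apply/chain_inP; exists j.+1.
Qed.

Lemma SC_chain_set k : SC W S c k = #|chain_set T N c k|.
Proof.
apply: eq_card => x; case: (tupleP x) => x0 {x} s; rewrite !inE !theadE /=.
by rewrite -chainsP.
Qed.
End NoncrossingChains.

(** * Chebyshev values and twice the cosine of pi/m *)

Section Chebyshev.
Local Open Scope ring_scope.
Variable R : realType.
Implicit Types (a theta : R) (k m : nat).

(** Chebyshev polynomials of the second kind with shifted index: at [a = 2 cos theta] the value is
    [sin (k theta) / sin theta]. *)
Fixpoint chebU a k : R :=
  if k is k1.+1 then if k1 is k2.+1 then a * chebU a k1 - chebU a k2 else 1
  else 0.

Lemma chebUS a k : chebU a k.+2 = a * chebU a k.+1 - chebU a k.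
Proof. by []. Qed.

Lemma chebU_sin theta k :
  chebU (cos theta *+ 2) k * sin theta = sin (theta *+ k).
Proof.
elim/ltn_ind: k => -[|[|k]] IHk; rewrite ?mul0r ?mulr0n ?sin0 ?mul1r //.
rewrite chebUS mulrBl -mulrA !IHk // [in RHS]mulrS sinD [in sin (_ *+ k)]/=.
have ->: theta *+ k = theta *+ k.+1 - theta by rewrite mulrS addrC addrK.
by rewrite sinB -mulr_natl; ring.
Qed.

Definition twice_cos m : R := cos (pi / m%:R) *+ 2.

(** Nonnegativity up to [m] serves the signs of roots, the values at [m + m] and its successor the
    dihedral relation, [a ^+ 2 < 4] the nondegeneracy of the plane of two roots, and [1 <= a] the
    bound on off-diagonal Cartan entries. *)
Lemma twice_cosP m (a := twice_cos m) : (1 < m)%N ->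
  [/\ forall k, (k <= m)%N -> 0 <= chebU a k, chebU a (m + m) = 0,
      chebU a (m + m).+1 = 1 & [/\ a ^+ 2 < 4, 0 <= a & (2 < m)%N -> 1 <= a]].
Proof.
move=> m_gt1; have m_gt0: 0 < m%:R :> R by rewrite ltr0n ltnW.
rewrite {}/a /twice_cos; set th := pi / m%:R; set a := cos th *+ 2.
have th_m: th *+ m = pi by rewrite -mulr_natr divfK ?gt_eqF.
have th_gt0: 0 < th by rewrite divr_gt0 ?pi_gt0.
have th_lt: th < pi by rewrite ltr_pdivrMr // ltr_pMr ?pi_gt0 // ltr1n.
have sin_gt0: 0 < sin th by rewrite sin_gt0_pi ?th_gt0.
have sin_neq0 := gt_eqF sin_gt0.
have U_ge0 k: (k <= m)%N -> 0 <= chebU a k.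
  move=> le_km; rewrite -(pmulr_lge0 _ sin_gt0) chebU_sin sin_ge0_pi //.
  by rewrite mulrn_wge0 ?(ltW th_gt0) //= -[leRHS]th_m ler_wpMn2l // ltW.
have a_ge0: 0 <= a by have := U_ge0 2 m_gt1; rewrite /= mulr1 subr0.
split=> //.
- apply: (mulIf (negbT sin_neq0)); rewrite chebU_sin mul0r mulrnDr th_m.
  by rewrite sinDpi sinpi oppr0.
- apply: (mulIf (negbT sin_neq0)); rewrite chebU_sin mul1r mulrS mulrnDr th_m.
  by rewrite addrA !sinDpi opprK.
- split=> // [|m_gt2].
    have := cos2Dsin2 th; have: 0 < sin th ^+ 2 by rewrite exprn_gt0.
    by rewrite /a; nra.
  have := U_ge0 3 m_gt2; rewrite /= mulr1 subr0; nra.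
Qed.
End Chebyshev.

(** * Positive definite forms and forests *)

Section SymmetricForms.
Import classical_sets.
Local Open Scope ring_scope.
Variables (R : realType) (n : nat).
Implicit Types (u v x y : 'cV[R]_n.+1) (M C : 'M[R]_n.+1) (i j k : 'I_n.+1).

Definition dot u v : R := (u^T *m v) 0 0.

Lemma dotE u v : dot u v = \sum_i u i 0 * v i 0.
Proof. by rewrite /dot mxE; apply: eq_bigr => i _; rewrite mxE. Qed.

Lemma dotC u v : dot u v = dot v u.
Proof. by rewrite !dotE; apply: eq_bigr => i _; rewrite mulrC. Qed.

Lemma dotDr u v x : dot u (v + x) = dot u v + dot u x.
Proof. by rewrite /dot mulmxDr mxE. Qed.

Lemma dotZr a u v : dot u (a *: v) = a * dot u v.
Proof. by rewrite /dot -scalemxAr mxE. Qed.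

Lemma dotDl u v x : dot (u + v) x = dot u x + dot v x.
Proof. by rewrite dotC dotDr !(dotC x). Qed.

Lemma dotZl a u v : dot (a *: u) v = a * dot u v.
Proof. by rewrite dotC dotZr dotC. Qed.

Lemma dot0r u : dot u 0 = 0.
Proof. by rewrite /dot mulmx0 mxE. Qed.

Lemma dotNr u v : dot u (- v) = - dot u v.
Proof. by rewrite -scaleN1r dotZr mulN1r. Qed.

Lemma dotNl u v : dot (- u) v = - dot u v.
Proof. by rewrite -scaleN1r dotZl mulN1r. Qed.

Lemma dot_mulmx u v M : dot u (M *m v) = dot (M^T *m u) v.
Proof. by rewrite /dot trmx_mul trmxK mulmxA. Qed.

Lemma dot_mulmxE u v M :
  dot u (M *m v) = \sum_i \sum_j u i 0 * M i j * v j 0.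
Proof.
rewrite dotE; apply: eq_bigr => i _; rewrite mxE big_distrr /=.
by apply: eq_bigr => j _; rewrite mulrA.
Qed.

Lemma dot_ge0 u : 0 <= dot u u.
Proof. by rewrite dotE sumr_ge0 // => i _; rewrite -expr2 sqr_ge0. Qed.

Lemma dot_eq0 u : (dot u u == 0) = (u == 0).
Proof.
apply/eqP/eqP => [|->]; last exact: dot0r.
rewrite dotE => /psumr_eq0P u0; apply/colP => i; rewrite mxE.
apply/eqP; rewrite -sqrf_eq0 expr2 u0 // => j _.
by rewrite -expr2 sqr_ge0.
Qed.

Lemma dot_gt0 u : (0 < dot u u) = (u != 0).
Proof. by rewrite lt_def dot_ge0 andbT dot_eq0. Qed.

Definition psd M := forall x, 0 <= dot x (M *m x).
Definition posdef M := forall x, x != 0 -> 0 < dot x (M *m x).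

Lemma psd_cauchy M u v : M^T = M -> psd M ->
  dot u (M *m v) ^+ 2 <= dot u (M *m u) * dot v (M *m v).
Proof.
move=> symM M_ge0.
set a := dot u (M *m u); set b := dot u (M *m v); set c := dot v _.
have quad t : 0 <= c + t * b *+ 2 + t ^+ 2 * a.
  have := M_ge0 (v + t *: u); rewrite mulmxDr -scalemxAr dotDr !dotDl !dotZr !dotZl.
  rewrite [dot v (M *m u)]dot_mulmx symM [dot _ u]dotC -/a -/b -/c.
  by congr (0 <= _); ring.
have a_ge0 : 0 <= a := M_ge0 u.
have [a0|a_neq0] := eqVneq a 0.
  have [->|b0] := eqVneq b 0; first by rewrite expr0n /= mulr_ge0 ?M_ge0.
  (* With [a = 0] the quadratic is affine in [t], and this choice of [t] makes it -1. *)
  have := quad (- (c + 1) / (b *+ 2)); rewrite a0 mulr0 addr0.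
  suff -> : c + - (c + 1) / (b *+ 2) * b *+ 2 = -1 by rewrite lerNr oppr0 ler10.
  by field.
have := quad (- b / a); rewrite -(pmulr_rge0 _ (_ : 0 < a)); last by rewrite lt_def a_neq0.
suff -> : a * (c + - b / a * b *+ 2 + (- b / a) ^+ 2 * a) = a * c - b ^+ 2 by rewrite subr_ge0.
by field.
Qed.

Lemma psd_kernel M x : M^T = M -> psd M -> dot x (M *m x) = 0 -> M *m x = 0.
Proof.
move=> symM M_ge0 x0; apply/eqP; rewrite -dot_eq0 -sqrf_eq0 eq_le sqr_ge0 andbT.
by rewrite (le_trans (psd_cauchy _ _ symM M_ge0)) // x0 mulr0.
Qed.

Lemma dot_bound M : exists2 K, 0 < K & forall x, dot x (M *m x) <= K * dot x x.
Proof.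
exists (\sum_i \sum_j `|M i j| + 1).
  by rewrite ltr_wpDl // sumr_ge0 // => i _; rewrite sumr_ge0.
move=> x; rewrite mulrDl mul1r ler_wpDr ?dot_ge0 // dot_mulmxE mulr_suml.
apply: ler_sum => i _; rewrite mulr_suml; apply: ler_sum => j _.
have sq k : `|x k 0| ^+ 2 <= dot x x.
  rewrite real_normK ?num_real // dotE (bigD1 k) //= -expr2 lerDl sumr_ge0 // => l _.
  by rewrite -expr2 sqr_ge0.
rewrite mulrAC (le_trans (ler_norm _)) // normrM mulrC ler_wpM2l //.
rewrite normrM -(ler_pM2r (ltr0n R 2)).
have := sq i; have := sq j.
move: (normr_ge0 (x i 0)) (normr_ge0 (x j 0)).
move: (`|x i 0|) (`|x j 0|) => a b a0 b0 ha hb.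
have := sqr_ge0 (a - b); nra.
Qed.

(** Cauchy-Schwarz for [x] and [invmx M *m x] bounds [dot x x ^+ 2] by [dot x (M *m x)] times the
    form of [invmx M] at [x], and the latter is at most [K * dot x x]. This avoids any compactness
    argument. *)
Lemma posdef_psd_bound M : M^T = M -> psd M -> \det M != 0 ->
  exists2 e, 0 < e & forall x, e * dot x x <= dot x (M *m x).
Proof.
move=> symM M_ge0 detM; have uM : M \in unitmx by rewrite unitmxE unitfE.
have [K K_gt0 Kb] := dot_bound (invmx M).
exists K^-1; rewrite ?invr_gt0 // => x.
have [->|x0] := eqVneq x 0; first by rewrite mulmx0 !dot0r mulr0.
have := psd_cauchy x (invmx M *m x) symM M_ge0.
rewrite mulmxA mulmxV // mul1mx [dot (invmx M *m x) x]dotC.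
have := Kb x; have := M_ge0 x; rewrite -dot_gt0 in x0.
move: (dot x x) (dot x (M *m x)) (dot x (invmx M *m x)) x0 => d q r d0 q0 rK dq.
rewrite ler_pdivrMl //.
have : d * d <= q * (K * d) by rewrite -expr2 (le_trans dq) // ler_wpM2l.
by rewrite mulrA ler_pM2r // [q * K]mulrC.
Qed.

(* [mu] is the largest number with [C - mu] positive semidefinite; then [C - mu]
   is singular, and taking absolute values in a kernel vector keeps it in the
   kernel since the off-diagonal entries are nonpositive. *)
Lemma perron_frobenius C :
    C^T = C -> posdef C -> (forall i j, i != j -> C i j <= 0) ->
    (forall i j, connect [rel i j | C i j != 0] i j) ->
  exists (mu : R) (d : 'cV[R]_n.+1), (forall i, 0 < d i 0) /\ C *m d = mu *: d.
Proof.
move=> symC posC C_le0 connC.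
pose E : set R := [set mu | forall x, mu * dot x x <= dot x (C *m x)]%classic.
have E0 : E 0.
  move=> x; rewrite mul0r; have [->|/posC/ltW//] := eqVneq x 0.
  by rewrite mulmx0 dot0r.
have [K _ Kb] := dot_bound C.
have ubE : ubound E K.
  move=> mu /(_ (delta_mx 0 0))/le_trans/(_ (Kb _)); rewrite ler_pM2r // dot_gt0.
  by apply/eqP => /colP/(_ 0)/eqP; rewrite !mxE !eqxx oner_eq0.
have supE : has_sup E by split; [exists 0 | exists K].
pose mu := sup E.
have Emu : E mu.
  move=> x; have [->|x0] := eqVneq x 0; first by rewrite mulmx0 !dot0r mulr0.
  rewrite -ler_pdivlMr ?dot_gt0 //; apply: ge_sup; first by exists 0.
  by move=> nu Enu; rewrite ler_pdivlMr ?dot_gt0.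
pose M := C - mu%:M.
have ME x : M *m x = C *m x - mu *: x by rewrite mulmxBl mul_scalar_mx.
have symM : M^T = M by rewrite linearB /= symC tr_scalar_mx.
have M_ge0 : psd M.
  by move=> x; rewrite ME dotDr dotNr dotZr subr_ge0; apply: Emu.
(* Otherwise a positive [e] could be added to [mu], against its being the supremum. *)
have detM : \det M = 0.
  apply/eqP/negPn/negP => /(posdef_psd_bound symM M_ge0)[e e_gt0 eM].
  have : mu + e <= mu.
    apply: ub_le_sup => [|x]; first by exists K.
    by rewrite mulrDl -lerBrDl (le_trans (eM x)) // ME dotDr dotNr dotZr.
  by rewrite gerDl leNgt e_gt0.
have [r r0 rM] : exists2 v : 'rV_n.+1, v != 0 & v *m M = 0 by apply/det0P/eqP.
pose x := r^T; have x0 : x != 0 by rewrite trmx_eq0.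
have Mx : M *m x = 0 by rewrite -(trmxK M) -trmx_mul symM rM trmx0.
pose y : 'cV[R]_n.+1 := \col_i `|x i 0|.
have y_ge0 i : 0 <= y i 0 by rewrite mxE.
have y0 : y != 0.
  apply: contraNneq x0 => /colP y0; apply/eqP/colP => i.
  by have := y0 i; rewrite !mxE => /eqP; rewrite normr_eq0 => /eqP.
have My : M *m y = 0.
  apply: psd_kernel => //; apply/eqP; rewrite eq_le M_ge0 andbT.
  rewrite -[leRHS](dot0r x) -Mx !dot_mulmxE; apply: ler_sum => i _.
  apply: ler_sum => j _; rewrite mulrAC [leRHS]mulrAC ![y _ _]mxE -normrM.
  have [->|neq_ij] := eqVneq i j.
    by rewrite -expr2 ger0_norm ?sqr_ge0.
  have Mij : M i j <= 0 by rewrite !mxE (negPf neq_ij) subr0 C_le0.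
  by rewrite ler_wnM2r // ler_norm.
have Cy : C *m y = mu *: y by apply/eqP; rewrite -subr_eq0 -ME My.
exists mu, y; split=> // i; rewrite lt_def y_ge0 andbT.
apply: contraNneq y0 => yi0; apply/eqP/colP => j; rewrite [RHS]mxE.
(* In a row [k] with [y k 0 = 0] the terms [C k m * y m 0] are all nonpositive and sum to 0. Zeros
   of [y] thus spread along edges, and connectedness would force [y = 0]. *)
have step k l : y k 0 = 0 -> C k l != 0 -> y l 0 = 0.
  move=> yk0 Ckl; have := congr1 (fun z : 'cV_n.+1 => z k 0) Cy.
  rewrite [RHS]mxE yk0 mulr0 mxE => /eqP; rewrite -oppr_eq0 -sumrN => /eqP.
  move/psumr_eq0P => C0; have: - (C k l * y l 0) = 0.
    apply: C0 => // m _; have [<-|neq_km] := eqVneq k m; first by rewrite yk0 mulr0 oppr0.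
    by rewrite -mulNr mulr_ge0 // oppr_ge0 C_le0.
  by move/eqP; rewrite oppr_eq0 mulf_eq0 (negPf Ckl) => /eqP.
have /connectP[p pth ->] := connC i j.
elim: p i yi0 pth => //= k p IHp i yi0 /andP[Cik pth].
exact: IHp (step _ _ yi0 Cik) pth.
Qed.

End SymmetricForms.

Section Forests.
Variables (I : finType) (e : rel I).

(** Acyclicity in the form that inductions consume: every nonempty set of vertices contains one with
    at most one neighbour inside the set. *)
Definition forest := forall J : {set I}, J != set0 ->
  exists i, exists u, i \in J /\ forall v, v \in J -> e i v -> v = u.

Hypothesis e_sym : symmetric e.
Hypothesis e_irr : irreflexive e.

Lemma forest_2colour : forest ->
  exists col : I -> bool, forall i j, e i j -> col i != col j.
Proof.
move=> leaf.
suff colJ (J : {set I}) : exists col : I -> bool,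
    forall i j, i \in J -> j \in J -> e i j -> col i != col j.
  by have [col colP] := colJ setT; exists col => i j; apply: colP; rewrite inE.
elim: {J}#|J| {-2}J (leqnn #|J|) => [|m IHm] J leJ.
  exists xpredT => i j Ji; move: leJ; rewrite leqn0 cards_eq0 => /eqP J0.
  by rewrite J0 inE in Ji.
have [J0|J0] := eqVneq J set0; first by exists xpredT => i j; rewrite J0 inE.
have [i [u [Ji leafi]]] := leaf _ J0.
have [|col colP] := IHm (J :\ i); first by move: leJ; rewrite (cardsD1 i) Ji.
exists (fun j => if j == i then ~~ col u else col j) => a b Ja Jb eab.
have [def_a|nai] := eqVneq a i; have [def_b|nbi] := eqVneq b i.
- by rewrite def_a def_b e_irr in eab.
- by rewrite def_a in eab; rewrite (leafi b Jb eab); case: (col u).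
- by rewrite def_b e_sym in eab; rewrite (leafi a Ja eab); case: (col u).
by apply: colP => //; rewrite !inE ?nai ?nbi.
Qed.

(** For generators whose nonadjacent pairs commute, each of these moves conjugates the product of
    the word: a swap leaves it unchanged, and a rotation conjugates it by the moved letter. *)
Inductive conj_words : seq I -> seq I -> Prop :=
| ConjRefl a : conj_words a a
| ConjSym a b : conj_words a b -> conj_words b a
| ConjTrans a b c : conj_words a b -> conj_words b c -> conj_words a c
| ConjSwap a i j b : ~~ e i j -> conj_words (a ++ i :: j :: b) (a ++ j :: i :: b)
| ConjRot i a : conj_words (i :: a) (rcons a i).

Lemma conj_words_perm a b : conj_words a b -> perm_eq a b.
Proof.
elim=> {a b} // [a b _|a b c _ pab _|a i j b _|i a].
- by rewrite perm_sym.
- exact: perm_trans.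
- by rewrite perm_cat2l (perm_catCA [:: i] [:: j]).
- by rewrite perm_sym perm_rcons.
Qed.

Lemma conj_words_rot a b : conj_words (a ++ b) (b ++ a).
Proof.
elim: a b => [|i a IHa] b; first by rewrite cats0; apply: ConjRefl.
apply: ConjTrans (ConjRot i (a ++ b)) _; rewrite rcons_cat.
by apply: ConjTrans (IHa _) _; rewrite cat_rcons; apply: ConjRefl.
Qed.

Lemma conj_words_commute s p a : (forall v, v \in a -> ~~ e s v) ->
  conj_words (p ++ s :: a) (p ++ rcons a s).
Proof.
elim: a p => [|i a IHa] p nsa; first exact: ConjRefl.
apply: ConjTrans (ConjSwap p a (nsa i (mem_head _ _))) _.
rewrite -cat_rcons -[p ++ _]cat_rcons; apply: IHa => v va.
by apply: nsa; rewrite inE va orbT.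
Qed.

(** Only a rotation of [a] is obstructed by the letter [s] in front. As [s] has at most one
    neighbour in the word, it can be moved past either the rotated letter or all the others. *)
Lemma conj_words_leaf s u a b :
    conj_words a b -> uniq a -> (forall v, v \in a -> e s v -> v = u) ->
  conj_words (s :: a) (s :: b).
Proof.
elim=> {a b} [a|a b lev_coef IHab|a b c lev_coef IHab bc IHbc|a i j b nij|i a] Ua leaf.
- exact: ConjRefl.
- apply: ConjSym; apply: IHab => [|v va]; last first.
    by apply: leaf; rewrite -(perm_mem (conj_words_perm lev_coef)).
  by rewrite (perm_uniq (conj_words_perm lev_coef)).
- apply: ConjTrans (IHab Ua leaf) (IHbc _ _).
    by rewrite -(perm_uniq (conj_words_perm lev_coef)).
  by move=> v; rewrite -(perm_mem (conj_words_perm lev_coef)); apply: leaf.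
- exact: (ConjSwap (s :: a)).
have rot_i : conj_words (i :: s :: a) (s :: rcons a i) := ConjRot i (s :: a).
have [esi|nsi] := boolP (e s i); last first.
  exact: ConjTrans (ConjSwap [::] a nsi) rot_i.
(* Here [i] is the only neighbour of [s]: rotate [s] to the end, bring it back through [a] to just
   behind [i], then rotate [i]. *)
apply: ConjTrans (ConjRot s (i :: a)) _; apply: ConjTrans _ rot_i.
apply/ConjSym/(conj_words_commute [:: i]) => v va; apply/negP => esv.
have ia : v \in i :: a by rewrite inE va orbT.
have v_i: v = i := etrans (leaf v ia esv) (esym (leaf i (mem_head i a) esi)).
by move: Ua; rewrite /= -v_i va.
Qed.

(** Rotate a leaf to the front of both words; the rest agrees up to moves by induction, and the
    moves lift past the leaf. *)
Lemma forest_conj_words a b :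
  forest -> uniq a -> perm_eq a b -> conj_words a b.
Proof.
move=> leaf; elim: {a}(size a) {-2}a b (leqnn (size a)) => [|m IHm] a b le_am Ua pab.
  have /size0nil a0 : size a = 0%N by lia.
  move: pab; rewrite a0 perm_sym => /perm_nilP->.
  exact: ConjRefl.
have [a0|a0] := eqVneq [set i in a] set0.
  case: a a0 pab {le_am Ua} => [_ pab|i a /setP/(_ i)]; last by rewrite !inE eqxx.
  by move: pab; rewrite perm_sym => /perm_nilP->; apply: ConjRefl.
have [i [u [ia leafi]]] := leaf _ a0; rewrite inE in ia.
have rot_to c : i \in c -> exists2 d, conj_words c (i :: d) & perm_eq c (i :: d).
  case/splitPr => p q; have rot := conj_words_rot p (i :: q).
  by exists (q ++ p) => //; apply: conj_words_perm rot.
have [d ad pad] := rot_to a ia.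
have [f bf pbf] : exists2 d, conj_words b (i :: d) & perm_eq b (i :: d).
  by apply: rot_to; rewrite -(perm_mem pab).
have pdf : perm_eq d f.
  rewrite -(perm_cons i); apply: perm_trans pbf.
  by apply: perm_trans pab; rewrite perm_sym.
have Ud : uniq (i :: d) by rewrite -(perm_uniq pad).
apply: ConjTrans ad _; apply: ConjTrans _ (ConjSym bf).
have /andP[_ Ud'] := Ud.
apply: (@conj_words_leaf _ u) => // [|v vd].
  by apply: IHm => //; have := perm_size pad; rewrite /= => sz; rewrite -ltnS -sz.
by apply: leafi; rewrite inE (perm_mem pad) inE vd orbT.
Qed.

End Forests.

Section PosdefForest.
Local Open Scope ring_scope.
Variables (R : realType) (n : nat) (C : 'M[R]_n.+1).
Implicit Types i j : 'I_n.+1.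

(** If every vertex of [J] had two neighbours in [J], each row of the form at the indicator vector
    of [J] would contribute at most 2 - 2, contradicting positivity. *)
Lemma posdef_forest : posdef C -> (forall i, C i i = 2) ->
    (forall i j, i != j -> C i j <= 0 /\ (C i j != 0 -> C i j <= -1)) ->
  forest [rel i j | (i != j) && (C i j != 0)].
Proof.
move=> posC Cii offC J J0.
have [i Ji leaf] : exists2 i, i \in J &
  (#|[set j in J | (i != j) && (C i j != 0%R)]| <= 1)%N.
  apply/exists_inP; apply: contraT => /exists_inPn deg2.
  pose v : 'cV[R]_n.+1 := \col_i (i \in J)%:R.
  have v0 : v != 0.
    have [i Ji] := set0Pn _ J0; apply/eqP => /colP/(_ i)/eqP.
    by rewrite !mxE Ji oner_eq0.
  have := posC v v0; rewrite ltNge => /negP[].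
  rewrite dot_mulmxE sumr_le0 // => i _; rewrite mxE.
  have [Ji|_] := boolP (i \in J); last by rewrite big1 // => j _; rewrite !mul0r.
  have /negbTE := deg2 i Ji; rewrite leqNgt => /negbFE; set D := [set _ in J | _] => D2.
  have DJ : D \subset J by apply/subsetP => j; rewrite inE => /andP[].
  have niD : i \notin D by rewrite inE eqxx andbF.
  rewrite (bigD1 i) //= mxE Ji mul1r mulr1 Cii.
  rewrite (bigID [in D]) /=.
  have le_D : \sum_(j < n.+1 | (j != i) && (j \in D)) 1 * C i j * v j 0 <= - (#|D|%:R).
    rewrite -sumr_const -sumrN (eq_bigl [in D]) => [|j]; last first.
      by rewrite andb_idl //; apply: contraTneq => ->.
    apply: ler_sum => j; rewrite inE => /and3P[Jj nij Cij].
    by rewrite mxE Jj mul1r mulr1; apply: (offC _ _ nij).2.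
  have le_ND : \sum_(j < n.+1 | (j != i) && (j \notin D)) 1 * C i j * v j 0 <= 0.
    rewrite sumr_le0 // => j /andP[nji _]; rewrite mul1r mxE.
    by rewrite mulr_le0_ge0 ?ler0n //; apply: (offC i j _).1; rewrite eq_sym.
  have : 2 <= #|D|%:R :> R by rewrite ler_nat.
  by lra.
have [D0|[u Du]] := set_0Vmem [set j in J | (i != j) && (C i j != 0)]; last first.
  exists i, u; split=> // v Jv eiv.
  by rewrite -(card_le1_eqP leaf v u) // inE Jv; apply: eiv.
exists i, i; split=> // v Jv eiv.
by move/setP/(_ v): D0; rewrite !inE Jv [X in X = _]eiv.
Qed.
End PosdefForest.

(** * The geometric representation *)

Section ReflectionMatrices.
Local Open Scope ring_scope.
Variables (R : realType) (n : nat).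
Implicit Types (C : 'M[R]_n.+1) (i j k : 'I_n.+1) (v : 'cV[R]_n.+1).

Definition sroot i : 'cV[R]_n.+1 := delta_mx i 0.

Lemma srootE i k l : sroot i k l = (k == i)%:R.
Proof. by rewrite mxE [l]ord1 eqxx andbT. Qed.

Definition refl_mx C i : 'M[R]_n.+1 := 1 - delta_mx i i *m C.

Lemma refl_mx_entry C i k j :
  refl_mx C i k j = (k == j)%:R - (k == i)%:R * C i j.
Proof.
rewrite /refl_mx !mxE (bigD1 i) //= big1 ?addr0 => [|l /negPf nli].
  by rewrite !mxE eqxx andbT.
by rewrite !mxE nli andbF mul0r.
Qed.

Lemma refl_mxE C i v : refl_mx C i *m v = v - (C *m v) i 0 *: sroot i.
Proof.
rewrite mulmxBl mul1mx -mulmxA; congr (_ - _); apply/colP => k.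
rewrite !mxE (bigD1 i) //= big1 ?addr0 => [|l /negPf nli].
  by rewrite !mxE !eqxx !andbT mulrC.
by rewrite !mxE nli andbF mul0r.
Qed.

Lemma mulmx_sroot C i k : (C *m sroot i) k 0 = C k i.
Proof. by rewrite -colE mxE. Qed.

Lemma mulmx_srootC C i : C *m sroot i = col i C.
Proof. by rewrite colE. Qed.

Lemma eq_mulmx (A B : 'M[R]_n.+1) : (forall v, A *m v = B *m v) -> A = B.
Proof.
move=> eqAB; apply/matrixP => i j.
by rewrite -!mulmx_sroot eqAB.
Qed.

Lemma refl_mx_root C i : C i i = 2 -> refl_mx C i *m sroot i = - sroot i.
Proof.
move=> Cii; rewrite refl_mxE mulmx_sroot Cii scaler_nat mulr2n.
by rewrite opprD addrA subrr sub0r.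
Qed.

Lemma refl_mxK C i : C i i = 2 -> refl_mx C i * refl_mx C i = 1.
Proof.
move=> Cii; apply: eq_mulmx => v; rewrite -mulmxA mul1mx [refl_mx C i *m v]refl_mxE.
by rewrite mulmxBr -scalemxAr refl_mx_root // refl_mxE scalerN opprK subrK.
Qed.

(* Both reflections fix the vectors [C]-orthogonal to the plane of the two roots,
   so the order of their product is read off that plane. *)
Lemma refl_mx_dihedral C i j m (a : R) :
    C i i = 2 -> C j j = 2 -> C i j = - a -> C j i = - a -> a ^+ 2 < 4 ->
    chebU a (m + m) = 0 -> chebU a (m + m).+1 = 1 ->
  (refl_mx C i * refl_mx C j) ^+ m = 1.
Proof.
move=> Cii Cjj Cij Cji a_lt2 U0 U1.
(* Stated for an arbitrary ordered pair, since it is applied to the product and, with the roots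
   exchanged, to its inverse [Q]. *)
have rot i' j' q : C i' i' = 2 -> C j' j' = 2 -> C i' j' = - a -> C j' i' = - a ->
  (refl_mx C i' * refl_mx C j') ^+ q *m sroot i'
    = chebU a (q + q).+1 *: sroot i' + chebU a (q + q) *: sroot j'.
  move=> Cii' Cjj' Cij' Cji'; elim: q => [|q IHq].
    by rewrite expr0 mul1mx scale1r scale0r addr0.
  rewrite exprS -mulmxA IHq -mulmxA.
  set x := chebU a _; set y := chebU a _.
  have ->: refl_mx C j' *m (x *: sroot i' + y *: sroot j')
      = x *: sroot i' + (a * x - y) *: sroot j'.
    rewrite refl_mxE mulmxDr -!scalemxAr !mulmx_srootC; apply/colP => k.
    rewrite !mxE Cjj' Cji'; ring.
  rewrite refl_mxE mulmxDr -!scalemxAr !mulmx_srootC.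
  rewrite addSn addnS !chebUS -/x -/y; apply/colP => k.
  rewrite !mxE Cii' Cij'; ring.
set P := refl_mx C i * refl_mx C j.
have fixi : P ^+ m *m sroot i = sroot i.
  by rewrite rot // U0 U1 scale0r addr0 scale1r.
pose Q := refl_mx C j * refl_mx C i.
have PQ : P * Q = 1 by rewrite /P /Q mulrA -(mulrA (refl_mx C _)) !refl_mxK // mulr1 refl_mxK.
have QP : Q * P = 1 by rewrite /P /Q mulrA -(mulrA (refl_mx C _)) !refl_mxK // mulr1 refl_mxK.
have fixj : P ^+ m *m sroot j = sroot j.
  have {1}<-: Q ^+ m *m sroot j = sroot j.
    by rewrite rot // U0 U1 scale0r addr0 scale1r.
  rewrite mulmxA -[_ *m Q ^+ m]/(P ^+ m * Q ^+ m) -exprMn_comm ?PQ //.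
    by rewrite expr1n mul1mx.
  by rewrite /GRing.comm PQ QP.
apply: eq_mulmx => v; rewrite mul1mx.
(* [D] is the determinant of the Gram matrix of the two roots; [x] and [y] are given by Cramer's
   rule, so that [q] is orthogonal to both. *)
pose D := 4 - a ^+ 2; have D0: D != 0 by rewrite subr_eq0 gt_eqF.
pose p := (C *m v) i 0; pose r := (C *m v) j 0.
pose x := (p *+ 2 + a * r) / D; pose y := (r *+ 2 + a * p) / D.
pose q := v - (x *: sroot i + y *: sroot j).
have -> : v = q + (x *: sroot i + y *: sroot j) by rewrite subrK.
have Cq : (C *m q) i 0 = 0 /\ (C *m q) j 0 = 0.
  have CqE k : (C *m q) k 0 = (C *m v) k 0 - (x * C k i + y * C k j).
    by rewrite /q mulmxBr mulmxDr -!scalemxAr !mulmx_srootC !mxE.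
  rewrite !CqE Cii Cij Cjj Cji -/p -/r /x /y.
  by move: D0; rewrite /D => D0; split; field.
have fixq (l : nat) : P ^+ l *m q = q.
  elim: l => [|l IHl]; first by rewrite expr0 mul1mx.
  rewrite exprSr -mulmxA /P -mulmxA [refl_mx C j *m q]refl_mxE Cq.2 scale0r subr0.
  by rewrite refl_mxE Cq.1 scale0r subr0.
by rewrite mulmxDr fixq mulmxDr -!scalemxAr fixi fixj.
Qed.

End ReflectionMatrices.

Section UnitGroup.
Local Open Scope ring_scope.
Variable R : unitRingType.

(** The universal property of the presentation asks for a group as target; the invertible matrices
    are made into one here. *)
Definition unit_group := {x : R | x \is a GRing.unit}.
HB.instance Definition _ := Choice.on unit_group.
Implicit Types x y : unit_group.

Let one : unit_group := exist _ 1 (@unitr1 R).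
Let unit_invP x : (val x)^-1 \is a GRing.unit.
Proof. by rewrite unitrV (valP x). Qed.
Let inv x : unit_group := exist _ (val x)^-1 (unit_invP x).
Let unit_mulP x y : val x * val y \is a GRing.unit.
Proof. by rewrite (unitrMr _ (valP x)) (valP y). Qed.
Let mul x y : unit_group := exist _ (val x * val y) (unit_mulP x y).
Let mulA : associative mul.
Proof. by move=> x y z; apply/val_inj/mulrA. Qed.
Let mul1 : left_id one mul.
Proof. by move=> x; apply/val_inj/mul1r. Qed.
Let mulr1' : right_id one mul.
Proof. by move=> x; apply/val_inj/mulr1. Qed.
Let mulV : left_inverse one inv mul.
Proof. by move=> x; apply/val_inj/mulVr/(valP x). Qed.
Let mulrV' : right_inverse one inv mul.
Proof. by move=> x; apply/val_inj/mulrV/(valP x). Qed.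

HB.instance Definition _ :=
  isGroup.Build unit_group mulA mul1 mulr1' mulV mulrV'.

Lemma val_unit_groupX x m : val (x ^+ m)%g = val x ^+ m.
Proof. by elim: m => // m IHm; rewrite expgS exprS -IHm. Qed.
End UnitGroup.

Section CoxeterGroup.
Variables (gT : finGroupType) (R : realType) (n : nat).
Variables (W : {group gT}) (S : {set gT}) (g : 'I_n.+1 -> gT).
Hypotheses (coxWS : coxeter_system W S) (g_inj : injective g).
Hypothesis imS : S = [set g i | i : 'I_n.+1].
Implicit Types (i j k : 'I_n.+1) (w x y t : gT) (v : 'cV[R]_n.+1).
Local Open Scope ring_scope.
Local Notation T := (reflections W S).

(** On the diagonal the order is 1 and the entry is -2 cos(pi) = 2, so one formula covers all
    entries. *)
Definition cartan : 'M[R]_n.+1 := \matrix_(i, j) - twice_cos R #[g i * g j]%g.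

Lemma gS i : g i \in S. Proof. by rewrite imS imset_f. Qed.

Lemma order_g i : #[g i]%g = 2%N.
Proof. by case: coxWS => _ ord2 _; apply/ord2/gS. Qed.

Lemma gK i : (g i * g i = 1)%g.
Proof. by rewrite -expg2 -(order_g i) expg_order. Qed.

Lemma gV i : (g i)^-1%g = g i.
Proof. by apply/eqP; rewrite eq_invg_mul gK. Qed.

Lemma order_gg i : #[g i * g i]%g = 1%N.
Proof. by rewrite gK order1. Qed.

Lemma order_gg_gt1 i j : i != j -> (1 < #[g i * g j]%g)%N.
Proof.
rewrite order_gt1 -eq_invg_mul gV; apply: contra => /eqP/g_inj->; exact: eqxx.
Qed.

Lemma order_ggC i j : #[g i * g j]%g = #[g j * g i]%g.
Proof. by rewrite -(orderJ (g i * g j) (g i)) conjgE mulgA mulKg. Qed.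

Lemma cartan_diag i : cartan i i = 2.
Proof.
rewrite mxE order_gg /twice_cos divr1 cospi.
by rewrite mulNrn opprK.
Qed.

Lemma cartan_sym i j : cartan i j = cartan j i.
Proof. by rewrite !mxE order_ggC. Qed.

Lemma geometric_rep :
  exists2 rho : gT -> 'M[R]_n.+1,
    {in W &, {morph rho : x y / (x * y)%g >-> x * y}}
    & forall i, rho (g i) = refl_mx cartan i.
Proof.
have refl_unit i : refl_mx cartan i \is a GRing.unit.
  apply/unitrP; exists (refl_mx cartan i).
  by rewrite refl_mxK ?cartan_diag.
pose s i : unit_group 'M[R]_n.+1 := exist (fun M => M \is a GRing.unit) _ (refl_unit i).
pose f (x : gT) := if [pick i | g i == x] is Some i then s i else 1%g.
have fg i : f (g i) = s i.
  rewrite /f; case: pickP => [j /eqP/g_inj->|/(_ i)] //=.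
  by rewrite eqxx.
case: coxWS => _ _ /(_ _ f)[|phi phiM phiS].
  move=> x y; rewrite imS => /imsetP[i _ ->] /imsetP[j _ ->].
  rewrite !fg; apply: val_inj; rewrite val_unit_groupX /=.
  have [->|neq_ij] := eqVneq i j.
    by rewrite order_gg expr1 refl_mxK ?cartan_diag.
  have [_ U0 U1 [lt4 _ _]] := twice_cosP R (order_gg_gt1 neq_ij).
  apply: refl_mx_dihedral U0 U1; rewrite ?cartan_diag ?mxE //.
  by rewrite order_ggC.
exists (fun x => val (phi x)) => [x y Wx Wy|i]; first by rewrite phiM.
by rewrite phiS ?gS // fg.
Qed.

Variable rho : gT -> 'M[R]_n.+1.
Hypothesis rhoM : {in W &, {morph rho : x y / (x * y)%g >-> x * y}}.
Local Notation C := cartan.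
Hypothesis rho_g : forall i, rho (g i) = refl_mx C i.
Local Notation Cii := cartan_diag.
Local Notation Csym := cartan_sym.

Lemma gW i : g i \in W.
Proof. by case: coxWS => <- _ _; apply/mem_gen/gS. Qed.
Hint Resolve gW : core.

Lemma rho1 : rho 1%g = 1.
Proof.
have := rho_g 0; rewrite -(mulg1 (g 0)) rhoM // rho_g.
move/(congr1 (mulmx (refl_mx C 0))).
by rewrite -[_ *m (_ * _)]/(_ * (_ * _)) mulrA -[_ *m _]/(_ * _) refl_mxK ?Cii // mul1r.
Qed.

Lemma rhoMv x y v : x \in W -> y \in W -> rho (x * y)%g *m v = rho x *m (rho y *m v).
Proof. by move=> Wx Wy; rewrite rhoM // mulmxA. Qed.

Lemma rho_root_g i : rho (g i) *m sroot R i = - sroot R i.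
Proof. by rewrite rho_g refl_mx_root ?Cii. Qed.

(** * Word length and the signs of roots *)

Let len_ex w : exists l : nat, (w \notin W) || (w \in S ^+ l)%g.
Proof.
have [Ww|] := boolP (w \in W); last by exists 0%N.
move: Ww; case: coxWS => <- _ _ /gen_prodgP[l [c Sc ->]].
exists l => /=; have ->: (\prod_(i < l) c i = \prod_(t <- [seq c q | q <- enum 'I_l]) t)%g.
  by rewrite big_map enumT.
have sz: size [seq c q | q <- enum 'I_l] = l by rewrite size_map size_enum_ord.
by rewrite -[X in (S ^+ X)%g]sz prod_mem_expg // => _ /mapP[q _ ->].
Qed.

Definition len w := ex_minn (len_ex w).

Lemma len_min w l : (w \in S ^+ l)%g -> (len w <= l)%N.
Proof. by rewrite /len; case: ex_minnP => m _ + Sw; apply; rewrite Sw orbT. Qed.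

Lemma len_mem w : w \in W -> (w \in S ^+ (len w))%g.
Proof. by rewrite /len; case: ex_minnP => m + _ Ww; rewrite Ww. Qed.

Lemma len_mulr w i : w \in W -> (len (w * g i)%g <= (len w).+1)%N.
Proof.
by move=> Ww; apply: len_min; rewrite expgSr mem_mulg ?len_mem ?gS.
Qed.

Lemma len_descent w : w \in W -> w != 1%g -> exists i, (len (w * g i)%g < len w)%N.
Proof.
move=> Ww; have := len_mem Ww; case def_l: (len w) => [|l].
  by rewrite expg0 inE => ->.
rewrite expgSr => /mulsgP[u s Su]; rewrite imS => /imsetP[i _ ->] -> _.
by exists i; rewrite -mulgA gK mulg1 ltnS len_min.
Qed.

Definition nneg v := forall k, 0 <= v k 0.

Fixpoint alt x y l : gT :=
  if l is l1.+1 then (alt x y l1 * (if odd l1 then y else x))%g else 1%g.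

Lemma alt_mem i j l : alt (g j) (g i) l \in W.
Proof. by elim: l => [|l IHl] /=; rewrite ?group1 // groupM //; case: ifP. Qed.
Hint Resolve alt_mem : core.

Lemma alt_double i j l : alt (g j) (g i) (l + l) = ((g j * g i) ^+ l)%g.
Proof.
elim: l => // l IHl; rewrite addSn addnS /= IHl expgSr.
by rewrite oddD addbb /= mulgA.
Qed.

(** Consecutive Chebyshev values appear as coefficients; both are nonnegative as long as [l] is
    smaller than the order of [g i * g j]. *)
Lemma rho_alt i j l (a := twice_cos R #[g i * g j]%g) : i != j ->
  rho (alt (g j) (g i) l)^-1%g *m sroot R i
    = if odd l then chebU a l *: sroot R i + chebU a l.+1 *: sroot R j
      else chebU a l.+1 *: sroot R i + chebU a l *: sroot R j.
Proof.
move=> neq_ij; have Cij: C i j = - a by rewrite mxE.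
elim: l => [|l IHl]; first by rewrite /= invg1 rho1 mul1mx scale1r scale0r addr0.
have sE (x y : R) : refl_mx C i *m (x *: sroot R i + y *: sroot R j)
     = (a * y - x) *: sroot R i + y *: sroot R j.
  rewrite refl_mxE mulmxDr -!scalemxAr !mulmx_srootC; apply/colP => k.
  move: (Cii i) Cij; move: cartan => C0 Ci0 Cij0.
  rewrite !mxE Ci0 Cij0; ring.
have sE' (x y : R) : refl_mx C j *m (x *: sroot R i + y *: sroot R j)
     = x *: sroot R i + (a * x - y) *: sroot R j.
  rewrite refl_mxE mulmxDr -!scalemxAr !mulmx_srootC; apply/colP => k.
  move: (Cii j) Cij; rewrite Csym; move: cartan => C0 Ci0 Cij0.
  rewrite !mxE Ci0 Cij0; ring.
have Wy: (if odd l then g i else g j) \in W by case: ifP.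
rewrite [alt _ _ _]/= invMg rhoMv ?groupV // IHl /=.
by case: ifP => _ /=; rewrite gV ?rho_g ?sE ?sE' // chebUS.
Qed.

(* Tits' argument: strip from the right of [w] the longest alternating word
   [g j, g i, g j, ...] that shortens it at each step. Fewer than [#[g i * g j]]
   letters come off, and what remains is shortened by neither [g i] nor [g j]. *)
Lemma len_root w i :
  w \in W -> (len w <= len (w * g i)%g)%N -> nneg (rho w *m sroot R i).
Proof.
elim/ltn_ind: {w}(len w) {-2}w i (erefl (len w)) => p IHp w i def_p Ww le_wi.
have [->|nw1] := eqVneq w 1%g.
  by move=> k; rewrite rho1 mul1mx srootE ler0n.
have [j lt_wj] := len_descent Ww nw1.
have neq_ij: i != j by apply: contraTneq lt_wj => <-; rewrite -leqNgt.
pose f l := len (w * alt (g j) (g i) l)%g.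
have f0 : f 0%N = len w by rewrite /f /= mulg1.
have f_step l : (f l.+1 <= (f l).+1)%N /\ (f l <= (f l.+1).+1)%N.
  rewrite /f /= mulgA; case: ifP => _.
    by split; last rewrite -{1}(mulgK (g i) (w * _)%g) gV; rewrite len_mulr // !groupM.
  by split; last rewrite -{1}(mulgK (g j) (w * _)%g) gV; rewrite len_mulr // !groupM.
have f_add l q : (f (l + q) <= f l + q)%N.
  elim: q => [|q IHq]; first by rewrite !addn0.
  by have [le1 _] := f_step (l + q)%N; rewrite (addnS l); lia.
have f_back l q : (f l <= f (l + q) + q)%N.
  elim: q => [|q IHq]; first by rewrite !addn0.
  by have [_ le1] := f_step (l + q)%N; rewrite (addnS l); lia.
pose P l := (f l + l <= f 0)%N.
have P1: P 1%N by rewrite /P addn1 f0 /f /= mul1g.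
have Pub l : P l -> (l <= f 0)%N by rewrite /P; lia.
have [l Pl maxl] := ex_maxnP (ex_intro P _ P1) Pub.
have l_gt0 : (0 < l)%N by exact: maxl.
set m := #[g i * g j]%g.
have m_gt1 : (1 < m)%N by exact: order_gg_gt1.
(* The alternating word with 2m - 1 letters equals [g i]. After m shortening steps the m - 1
   remaining ones could not restore the length, so [w * g i] would be shorter than [w]. *)
have lt_lm : (l < m)%N.
  rewrite ltnNge; apply/negP => le_ml.
  have altE : alt (g j) (g i) (m + m).-1 = g i.
    have: alt (g j) (g i) (m + m) = 1%g by rewrite alt_double /m order_ggC expg_order.
    have /prednK <- : (0 < m + m)%N by lia.
    move=> /=; have ->: odd (m + m).-1 by lia.
    by move/(canRL (mulgK _)); rewrite mul1g gV.
  have := f_add m m.-1; have := f_back m (l - m)%N; rewrite subnKC //.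
  move: le_wi Pl; rewrite /P f0.
  have ->: (m + m.-1 = (m + m).-1)%N by lia.
  have ->: f (m + m).-1 = len (w * g i)%g by rewrite /f altE.
  by clear - m_gt1 le_ml; lia.
have [Uge0 _ _ _] := twice_cosP R m_gt1.
pose v := (w * alt (g j) (g i) l)%g.
have Wv : v \in W by rewrite groupM.
have def_w: w = (v * (alt (g j) (g i) l)^-1)%g by rewrite mulgK.
have lt_v : (len v < p)%N by rewrite -def_p -f0; move: Pl; rewrite /P /f -/v; lia.
have le_next : (f l <= f l.+1)%N.
  have: ~~ P l.+1 by apply/negP => /maxl; rewrite ltnn.
  by move: Pl; rewrite /P; lia.
have le_last : (f l <= f l.-1)%N by have := f_back 0%N l.-1; move: Pl; rewrite /P add0n; lia.
have fE : f l.+1 = len (v * if odd l then g i else g j)%g by rewrite /f /= mulgA.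
have fE' : f l.-1 = len (v * if odd l then g j else g i)%g.
  rewrite /f /v -(prednK l_gt0) /= mulgA; congr len.
  by case: (odd l.-1); rewrite /= -mulgA gK mulg1.
rewrite fE in le_next; rewrite fE' in le_last.
have [nn_i nn_j] : nneg (rho v *m sroot R i) /\ nneg (rho v *m sroot R j).
  have IHv k := IHp _ lt_v v k erefl Wv.
  by split; apply: IHv; move: le_next le_last; case: ifP.
rewrite def_w rhoMv ?groupV // rho_alt //.
have [Ul Ul1] := (Uge0 l (ltnW lt_lm), Uge0 _ lt_lm).
by move=> k; case: ifP => _; rewrite mulmxDr -!scalemxAr mxE;
  apply: addr_ge0; rewrite mxE mulr_ge0.
Qed.

Definition npos v := nneg (- v).

Lemma root_sign w i :
  w \in W -> nneg (rho w *m sroot R i) \/ npos (rho w *m sroot R i).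
Proof.
move=> Ww; case: (leqP (len w) (len (w * g i)%g)) => [|lt_wi].
  by left; apply: len_root.
right; rewrite /npos -mulmxN -rho_root_g -rhoMv //; apply: len_root.
  by rewrite groupM.
by rewrite -mulgA gK mulg1 ltnW.
Qed.

Lemma root_neq0 w i : w \in W -> rho w *m sroot R i != 0.
Proof.
move=> Ww; apply/eqP => /(congr1 (mulmx (rho w^-1%g))).
rewrite -rhoMv ?groupV // mulVg rho1 mul1mx mulmx0 => /colP/(_ i)/eqP.
by rewrite srootE eqxx mxE oner_eq0.
Qed.

Lemma nneg_npos v : nneg v -> npos v -> v = 0.
Proof.
move=> v_ge0 v_le0; apply/colP => k; apply/eqP; rewrite mxE eq_le v_ge0 andbT.
by have := v_le0 k; rewrite mxE oppr_ge0.
Qed.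

(** A nontrivial element has a descent, and a descent sends its simple root to a negative one. This
    is the source of faithfulness, and later of the bound on sign changes. *)
Lemma roots_nneg_eq1 w :
  w \in W -> (forall i, nneg (rho w *m sroot R i)) -> w = 1%g.
Proof.
move=> Ww wi_ge0; apply/eqP/negPn/negP => /(len_descent Ww)[i lt_wi].
have /negP[] := root_neq0 i Ww; apply/eqP/nneg_npos; first exact: wi_ge0.
rewrite /npos -mulmxN -rho_root_g -rhoMv //; apply: len_root.
  by rewrite groupM.
by rewrite -mulgA gK mulg1 ltnW.
Qed.

Lemma rho_inj : {in W &, injective rho}.
Proof.
move=> x y Wx Wy eq_xy; apply/eqP; rewrite eq_mulgV1; apply/eqP.
apply: roots_nneg_eq1 => [|i k]; first by rewrite groupM ?groupV.
by rewrite rhoM ?groupV // eq_xy -rhoM ?groupV // mulgV rho1 mul1mx srootE ler0n.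
Qed.

Lemma W_rev_ind (P : gT -> Prop) :
  P 1%g -> (forall w i, w \in W -> P w -> P (w * g i)%g) -> forall w, w \in W -> P w.
Proof.
move=> P1 PM w /len_mem; move: (len _) => l; elim: l w => [|l IHl] w.
  by rewrite expg0 inE => /eqP->.
rewrite expgSr => /mulsgP[u s Su]; rewrite imS => /imsetP[i _ ->] ->.
apply: PM (IHl _ Su); case/mem_expgP: Su => r [_ rS <-]; rewrite big_seq.
by rewrite group_prod // => t /rS; rewrite imS => /imsetP[k _ ->].
Qed.

Lemma twice_cos2 : twice_cos R 2 = 0.
Proof. by rewrite /twice_cos cos_pihalf mul0rn. Qed.

Lemma cartan_offdiag i j : i != j -> C i j <= 0 /\ (C i j != 0 -> C i j <= -1).
Proof.
move=> /order_gg_gt1 m_gt1; have [_ _ _ [_ a_ge0 a_ge1]] := twice_cosP R m_gt1.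
rewrite mxE oppr_le0 oppr_eq0; split=> // a_neq0.
rewrite lerN2; apply: a_ge1; rewrite ltn_neqAle m_gt1 andbT.
by apply: contra a_neq0 => /eqP<-; rewrite twice_cos2.
Qed.

Lemma cartan0_commute i j : C i j = 0 -> commute (g i) (g j).
Proof.
have [->|neq_ij] := eqVneq i j; first by [].
rewrite mxE => /eqP; rewrite oppr_eq0 => /eqP a0.
have m_gt1 := order_gg_gt1 neq_ij.
have [_ _ _ [_ _ a_ge1]] := twice_cosP R m_gt1.
have m2 : #[g i * g j]%g = 2%N.
  apply/eqP; rewrite eqn_leq m_gt1 andbT leqNgt; apply/negP => /a_ge1.
  by rewrite a0 ler10.
have : ((g i * g j) * (g i * g j) = 1)%g by rewrite -expg2 -m2 expg_order.
by move/(canRL (mulgK _)); rewrite mul1g invMg !gV.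
Qed.

Lemma trmx_cartan : C^T = C.
Proof. by apply/matrixP => i j; rewrite mxE Csym. Qed.

Lemma dot_sroot i v : dot (sroot R i) v = v i 0.
Proof.
rewrite dotE (bigD1 i) //= big1 ?addr0 => [|k /negPf nki].
  by rewrite srootE eqxx mul1r.
by rewrite srootE nki mul0r.
Qed.

Lemma dot_cartanC u v : dot u (C *m v) = dot v (C *m u).
Proof. by rewrite dot_mulmx trmx_cartan dotC. Qed.

Lemma cartan_inv w u v : w \in W ->
  dot (rho w *m u) (C *m (rho w *m v)) = dot u (C *m v).
Proof.
move=> Ww; elim/W_rev_ind: w / Ww u v => [|w i Ww IHw] u v; first by rewrite rho1 !mul1mx.
rewrite !rhoMv // IHw rho_g !refl_mxE mulmxBr -scalemxAr mulmx_srootC.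
rewrite dotDl !dotDr !dotNl !dotNr !dotZl !dotZr.
rewrite -mulmx_srootC [dot u (C *m sroot R i)]dot_cartanC !dot_sroot.
rewrite mulmx_sroot Cii; ring.
Qed.

(* Averaging over [W] gives an invariant inner product [G]; since [C] is symmetric,
   simple roots that are not orthogonal have the same [G]-norm, so [C] is [2 G]
   in the basis of [G]-normalized simple roots. *)
Lemma cartan_posdef : posdef C.
Proof.
pose G := \sum_(w in W) (rho w)^T *m rho w.
have GE u v : dot u (G *m v) = \sum_(w in W) dot (rho w *m u) (rho w *m v).
  rewrite /dot mulmx_suml mulmx_sumr summxE; apply: eq_bigr => w _.
  by rewrite trmx_mul !mulmxA.
have Gpd u : u != 0 -> 0 < dot u (G *m u).
  move=> u0; rewrite GE (bigD1 1%g) ?group1 //= rho1 mul1mx.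
  by rewrite ltr_pwDl ?dot_gt0 // sumr_ge0 // => w _; apply: dot_ge0.
have Ginv y u v : y \in W -> dot (rho y *m u) (G *m (rho y *m v)) = dot u (G *m v).
  move=> Wy; rewrite !GE [RHS](reindex_inj (mulIg y)) /=.
  apply: eq_big => [w|w Ww]; first by rewrite groupMr.
  by rewrite !rhoMv.
have Gsym u v : dot u (G *m v) = dot v (G *m u).
  by rewrite !GE; apply: eq_bigr => w _; rewrite dotC.
pose N i := dot (sroot R i) (G *m sroot R i).
have N_gt0 i : 0 < N i.
  apply: Gpd; apply/eqP => /colP/(_ i)/eqP.
  by rewrite srootE eqxx mxE oner_eq0.
pose Gij i j := dot (sroot R i) (G *m sroot R j).
have CG i j : C i j * N i = Gij i j *+ 2.
  have := Ginv (g i) (sroot R i) (sroot R j) (gW i).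
  rewrite rho_root_g rho_g refl_mxE mulmxBr -scalemxAr mulmx_sroot.
  rewrite dotNl dotDr dotNr dotZr -/(N i) -/(Gij i j) => eqG.
  by rewrite mulr2n -{2}eqG; ring.
move=> x x0; pose y : 'cV[R]_n.+1 := \col_i (x i 0 / Num.sqrt (N i)).
suff -> : dot x (C *m x) = dot y (G *m y) *+ 2.
  rewrite pmulrn_lgt0 // Gpd //; apply: contraNneq x0 => /colP y0.
  apply/eqP/colP => i; have := y0 i; rewrite !mxE => /eqP.
  by rewrite mulf_eq0 invr_eq0 sqrtr_eq0 leNgt N_gt0 orbF => /eqP.
rewrite !dot_mulmxE -sumrMnl; apply: eq_bigr => i _; rewrite -sumrMnl.
apply: eq_bigr => j _; rewrite ![y _ _]mxE.
have -> : G i j = Gij i j by rewrite /Gij dot_sroot mulmx_sroot.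
have Ci : C i j = Gij i j *+ 2 / N i by rewrite -CG mulfK ?gt_eqF.
have Cj : C i j = Gij i j *+ 2 / N j.
  by rewrite Csym /Gij Gsym -/(Gij j i) -CG mulfK ?gt_eqF.
have [G0|G0] := eqVneq (Gij i j) 0.
  by rewrite Ci G0 mul0rn !(mul0r, mulr0, mul0rn).
have eqN : N i = N j.
  apply: invr_inj; apply: (mulfI (_ : Gij i j *+ 2 != 0)); last by rewrite -Ci -Cj.
  by rewrite mulrn_eq0.
rewrite Ci -eqN; have := sqr_sqrtr (ltW (N_gt0 i)).
have : Num.sqrt (N i) != 0 by rewrite sqrtr_eq0 leNgt N_gt0.
move: (Num.sqrt (N i)) => q q0 <-; by field.
Qed.

(** * Roots of reflections and parabolic subgroups *)

Implicit Types (b : 'cV[R]_n.+1) (bs : seq 'cV[R]_n.+1).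

Definition reflv b v := v - dot b (C *m v) *: b.

Lemma reflv_id b v : dot b (C *m v) = 0 -> reflv b v = v.
Proof. by move=> bv0; rewrite /reflv bv0 scale0r subr0. Qed.

Lemma reflvK b v : dot b (C *m b) = 2 -> reflv b (reflv b v) = v.
Proof.
move=> b2; rewrite /reflv mulmxBr -scalemxAr dotDr dotNr dotZr b2.
by apply/colP => k; rewrite !mxE; ring.
Qed.

Lemma foldr_reflv_span bs v : foldr reflv v bs - v \in <<bs>>%VS.
Proof.
elim: bs => [|b bs IHbs] /=; first by rewrite subrr mem0v.
by rewrite /reflv addrAC span_cons addrC memv_add // memvN memvZ // memv_line.
Qed.

(** Carter's argument: if the first reflection moved [v], the others would have to displace [v] by a
    nonzero multiple of [b], which puts [b] in their span. *)
Lemma reflv_free bs v :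
    free bs -> (forall b, b \in bs -> dot b (C *m b) = 2) ->
    foldr reflv v bs = v ->
  forall b, b \in bs -> dot b (C *m v) = 0.
Proof.
elim: bs => //= b bs IHbs; rewrite free_cons => /andP[nbX free_bs] norm2 fix_v.
have v_span := foldr_reflv_span bs v.
have norm_b := norm2 b (mem_head _ _).
have def_v : foldr reflv v bs = reflv b v by rewrite -{2}fix_v reflvK.
have bv0 : dot b (C *m v) = 0.
  apply/eqP; apply: contraR nbX => x0.
  move: v_span; rewrite def_v /reflv addrAC subrr add0r memvN => bX.
  by rewrite -[b]scale1r -(mulVf x0) -scalerA memvZ.
move=> b'; rewrite inE => /predU1P[->//|bs_b'].
apply: IHbs => // [c cbs|]; first by apply: norm2; rewrite inE cbs orbT.
by rewrite def_v reflv_id.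
Qed.

Lemma exists_orthogonal bs : (\dim <<bs>> < n.+1)%N ->
  exists2 v, v != 0 & forall b, b \in bs -> dot b (C *m v) = 0.
Proof.
set U := <<bs>>%VS => dimU.
pose A : 'M[R]_(\dim U, n.+1) := \matrix_(i, j) (vbasis U)`_i j 0.
have : kermx (A *m C)^T != 0.
  rewrite -mxrank_eq0 mxrank_ker mxrank_tr -lt0n subn_gt0.
  by rewrite (leq_ltn_trans _ dimU) // rank_leq_row.
case/rowV0Pn=> r /sub_kermxP rA r0; exists r^T; first by rewrite trmx_eq0.
have AC0 : A *m (C *m r^T) = 0.
  by rewrite mulmxA -(trmxK (A *m C)) -trmx_mul rA trmx0.
move=> b /memv_span/coord_vbasis->.
have basis0 (l : 'I_(\dim U)) : dot (vbasis U)`_l (C *m r^T) = 0.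
  have := congr1 (fun M : 'cV_(\dim U) => M l 0) AC0; rewrite !mxE => <-.
  by rewrite dotE; apply: eq_bigr => k _; rewrite [A _ _]mxE.
elim/big_ind: _ => [|u v u0 v0|l _]; first by rewrite dotC dot0r.
  by rewrite dotDl u0 v0 addr0.
by rewrite dotZl basis0 mulr0.
Qed.

Lemma det_cartan_neq0 : \det C != 0.
Proof.
apply/negP => /det0P[r r0 rC]; have := cartan_posdef (_ : r^T != 0).
rewrite trmx_eq0 => /(_ r0); rewrite -trmx_cartan -trmx_mul rC trmx0 dot0r.
by rewrite ltxx.
Qed.

Lemma cartan_ker v : C *m v = 0 -> v = 0.
Proof.
by move=> Cv; apply/eqP/negPn/negP => /cartan_posdef; rewrite Cv dot0r ltxx.
Qed.

Lemma reflectionsP t :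
  reflect (exists x i, x \in W /\ t = (x * g i * x^-1)%g) (t \in T).
Proof.
apply: (iffP imset2P) => [[s x + Wx ->]|[x [i [Wx ->]]]].
  rewrite imS => /imsetP[i _ ->]; exists x^-1%g, i.
  by rewrite groupV invgK -mulgA.
by exists (g i) x^-1%g; rewrite ?groupV ?gS // conjgE invgK mulgA.
Qed.

Lemma root_norm x i : x \in W ->
  dot (rho x *m sroot R i) (C *m (rho x *m sroot R i)) = 2.
Proof. by move=> Wx; rewrite cartan_inv // mulmx_srootC dot_sroot mxE Cii. Qed.

Lemma rho_reflection x i v : x \in W ->
  rho (x * g i * x^-1)%g *m v = reflv (rho x *m sroot R i) v.
Proof.
move=> Wx; rewrite !rhoMv ?groupM ?groupV // rho_g refl_mxE.
rewrite mulmxBr -scalemxAr -rhoMv ?groupV // mulgV rho1 mul1mx /reflv.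
rewrite -dot_sroot -(cartan_inv _ _ Wx) -rhoMv ?groupV // mulgV rho1 mul1mx.
by [].
Qed.

Lemma reflv_inj b b' : dot b (C *m b) = 2 -> dot b' (C *m b') = 2 ->
  reflv b =1 reflv b' -> b = b' \/ b = - b'.
Proof.
move=> b2 b2' /(_ b); rewrite /reflv b2 => /(congr1 (fun v => b - v)).
rewrite !opprB !(addrC b) !subrK.
set a := dot b' _ => eq_b.
have def_b : b = (a / 2) *: b'.
  by rewrite mulrC -scalerA -eq_b scalerA mulVf ?scale1r ?pnatr_eq0.
have : (a / 2) ^+ 2 = 1.
  move: b2; rewrite {1 2}def_b -scalemxAr dotZr dotZl b2' => b2.
  have two0 : 2 != 0 :> R by rewrite pnatr_eq0.
  by apply: (mulIf two0); rewrite mul1r expr2 -[RHS]b2 [RHS]mulrA.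
move/eqP; rewrite sqrf_eq1 => /orP[] /eqP a1; [left|right].
  by rewrite def_b a1 scale1r.
by rewrite def_b a1 scaleN1r.
Qed.

Lemma reflection_eq x i y j : x \in W -> y \in W ->
  (x * g i * x^-1 = y * g j * y^-1)%g <->
  rho x *m sroot R i = rho y *m sroot R j \/ rho x *m sroot R i = - (rho y *m sroot R j).
Proof.
move=> Wx Wy; split=> [eq_t|eq_b].
  apply: reflv_inj; rewrite ?root_norm // => v.
  by rewrite -!rho_reflection // eq_t.
apply: rho_inj; rewrite ?groupM ?groupV //; apply: eq_mulmx => v.
rewrite !rho_reflection //; case: eq_b => ->; rewrite // /reflv.
by rewrite dotNl scaleNr scalerN opprK.
Qed.

(** A root of [t] of arbitrarily chosen sign, with value 0 off the reflections. What is drawn from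
    it (norm, span, a vanishing coordinate) does not depend on the sign. *)
Definition rt t : 'cV[R]_n.+1 :=
  if [pick p : gT * 'I_n.+1 | (p.1 \in W) && (t == p.1 * g p.2 * p.1^-1)%g]
  is Some p then rho p.1 *m sroot R p.2 else 0.

Lemma rtP t : t \in T -> exists x i,
  [/\ x \in W, t = (x * g i * x^-1)%g & rt t = rho x *m sroot R i].
Proof.
case/reflectionsP=> x [i [Wx def_t]]; rewrite /rt; case: pickP => [[y j]|].
  by case/andP=> Wy /eqP-> /=; exists y, j.
by move/(_ (x, i)); rewrite /= Wx -def_t eqxx.
Qed.

Lemma rt_norm t : t \in T -> dot (rt t) (C *m rt t) = 2.
Proof. by case/rtP=> x [i [Wx _ ->]]; apply: root_norm. Qed.

Lemma gT_refl i : g i \in T.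
Proof. by apply/reflectionsP; exists 1%g, i; rewrite group1 mul1g invg1 mulg1. Qed.

Lemma T_sub_W : T \subset W.
Proof.
apply/subsetP => t /reflectionsP[x [i [Wx ->]]].
by rewrite !groupM ?groupV.
Qed.

Lemma rho_T_word (r : seq gT) v : {subset r <= T} ->
  rho (\prod_(t <- r) t)%g *m v = foldr reflv v (map rt r).
Proof.
elim: r => [|t r IHr] rT; first by rewrite big_nil rho1 mul1mx.
have Tt : t \in T by rewrite rT ?mem_head.
have rT' : {subset r <= T} by move=> u ur; rewrite rT // inE ur orbT.
have Wr : (\prod_(u <- r) u)%g \in W.
  by rewrite big_seq group_prod // => u /rT'; apply: (subsetP T_sub_W).
have Wt := subsetP T_sub_W t Tt.
rewrite big_cons rhoMv //= IHr //.
have [x [i [Wx -> ->]]] := rtP Tt.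
by rewrite rho_reflection.
Qed.

Definition gprod (a : seq 'I_n.+1) := (\prod_(i <- a) g i)%g.

Lemma gprodW a : gprod a \in W.
Proof. by rewrite /gprod group_prod. Qed.
Hint Resolve gprodW : core.

Lemma rho_gprod a v : rho (gprod a) *m v = foldr reflv v (map (@sroot R n) a).
Proof.
elim: a => [|i a IHa] /=; first by rewrite /gprod big_nil rho1 mul1mx.
rewrite /gprod big_cons rhoMv ?gprodW // -/(gprod a) IHa rho_g refl_mxE.
by rewrite /reflv dot_sroot.
Qed.

Lemma free_sroots a : uniq a -> free (map (@sroot R n) a).
Proof.
elim: a => [|i a IHa] /=; first by rewrite nil_free.
case/andP=> ia Ua; rewrite free_cons IHa // andbT; apply/negP => i_span.
have := @coord_span _ _ _ (in_tuple (map (@sroot R n) a)) _ i_span.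
move/(congr1 (fun v : 'cV[R]_n.+1 => v i 0)); rewrite srootE eqxx => /eqP.
rewrite summxE big1 ?oner_eq0 // => -[l] /= lt_l _.
have lt_la : (l < size a)%N by move: lt_l; rewrite size_map.
have nia : (i == nth i a l) = false by apply: contraNF ia => /eqP->; rewrite mem_nth.
by rewrite mxE (nth_map i) // srootE nia mulr0.
Qed.

Lemma gprod_fix a v : uniq a -> rho (gprod a) *m v = v ->
  forall i, i \in a -> (C *m v) i 0 = 0.
Proof.
move=> Ua; rewrite rho_gprod => fix_v i ia; rewrite -dot_sroot.
apply: reflv_free fix_v _ _; first exact: free_sroots; last exact: map_f.
by move=> _ /mapP[j _ ->]; rewrite dot_sroot mulmx_sroot Cii.
Qed.

Lemma coxeter_fix a v : uniq a -> (forall i, i \in a) ->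
  rho (gprod a) *m v = v -> v = 0.
Proof.
move=> Ua a_all fix_v; apply: cartan_ker; apply/colP => i.
by rewrite [RHS]mxE (gprod_fix Ua fix_v).
Qed.

(** A nonzero vector orthogonal to all the roots of the word would be fixed by the Coxeter element,
    which fixes only 0. *)
Lemma T_word_dim a (r : seq gT) : uniq a -> (forall i, i \in a) ->
  {subset r <= T} -> (\prod_(t <- r) t = gprod a)%g ->
  (n.+1 <= \dim <<map rt r>>)%N.
Proof.
move=> Ua a_all rT def_a; rewrite leqNgt; apply/negP => /exists_orthogonal[v v0 orth].
case/eqP: v0; apply: (coxeter_fix Ua a_all); rewrite -def_a rho_T_word //.
elim: {rT def_a} (map rt r) orth => //= b bs IH orth.
rewrite IH => [|b' bs_b']; last by rewrite orth // inE bs_b' orbT.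
by rewrite reflv_id // orth ?mem_head.
Qed.

Lemma coxeter_T_length a m : uniq a -> (forall i, i \in a) ->
  gprod a \in (T ^+ m)%g -> (n.+1 <= m)%N.
Proof.
move=> Ua a_all /mem_expgP[r [<- rT def_a]].
rewrite (leq_trans (T_word_dim Ua a_all rT def_a)) //.
by rewrite (leq_trans (dim_span _)) ?size_map.
Qed.

Lemma coxeter_word_free a (r : seq gT) : uniq a -> (forall i, i \in a) ->
  {subset r <= T} -> size r = n.+1 -> (\prod_(t <- r) t = gprod a)%g ->
  free (map rt r).
Proof.
move=> Ua a_all rT sz_r def_a; rewrite /free eqn_leq dim_span size_map sz_r.
exact: T_word_dim def_a.
Qed.

(* The [C]-dual vector of the simple root [i0] is fixed by [gprod a], hence, the
   roots of [r] being independent, by every letter of [r]. *)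
Lemma parabolic_word a i0 (r : seq gT) :
    uniq (i0 :: a) -> (forall i, i \in i0 :: a) ->
    {subset r <= T} -> size r = n -> (\prod_(t <- r) t = gprod a)%g ->
  forall t, t \in r -> rt t i0 0 = 0.
Proof.
move=> Ua a_all rT sz_r def_a t rt_t.
(* With [g i0] in front, [r] becomes a word of length [n.+1] for a Coxeter element, and such words
   have independent roots. *)
have free_r : free (map rt r).
  have : free (map rt (g i0 :: r)).
    apply: (coxeter_word_free Ua a_all) => /=; last 2 first.
    - by rewrite sz_r.
    - by rewrite big_cons /gprod big_cons -/(gprod a) def_a.
    by move=> u; rewrite inE => /predU1P[->|/rT//]; apply: gT_refl.
  by rewrite /= free_cons => /andP[].
pose v := invmx C *m sroot R i0.
have Cv : C *m v = sroot R i0.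
  by rewrite mulmxA mulmxV ?mul1mx // unitmxE unitfE det_cartan_neq0.
have fix_v : rho (gprod a) *m v = v.
  rewrite rho_gprod; move: Ua => /= /andP[]; elim: (a) => //= i b IHb.
  rewrite inE negb_or => /andP[ni0i i0b] /andP[_ Ub]; rewrite IHb // reflv_id //.
  by rewrite Cv dot_sroot srootE eq_sym (negPf ni0i).
rewrite -def_a rho_T_word // in fix_v.
have norm_r b : b \in map rt r -> dot b (C *m b) = 2.
  by case/mapP=> u /rT Tu ->; apply: rt_norm.
have := reflv_free free_r norm_r fix_v (map_f _ rt_t).
by rewrite Cv dotC dot_sroot.
Qed.

(** The reflection [g k] changes only coordinate [k], so all other coordinates must vanish; norm 2
    then leaves plus or minus the simple root. *)
Lemma nneg_refl_npos x i k : x \in W -> nneg (rho x *m sroot R i) ->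
  npos (rho (g k * x)%g *m sroot R i) -> rho x *m sroot R i = sroot R k.
Proof.
move=> Wx; rewrite rhoMv // rho_g refl_mxE; set b := rho x *m _ => nn_b np_b.
have bE : b = b k 0 *: sroot R k.
  apply/colP => j; rewrite [RHS]mxE srootE.
  have [->|njk] := eqVneq j k; first by rewrite mulr1.
  apply/eqP; rewrite mulr0 eq_le nn_b andbT; have := np_b j.
  rewrite mxE [X in - X]mxE [X in _ + X]mxE [X in _ - X]mxE srootE (negPf njk).
  by rewrite mulr0 subr0 oppr_ge0.
suff bk1 : b k 0 = 1 by rewrite bE bk1 scale1r.
have := root_norm i Wx; rewrite -/b {1 2}bE -scalemxAr dotZr dotZl.
rewrite dot_sroot (mulmx_sroot C) Cii => /eqP; rewrite mulrA -subr_eq0.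
have -> : b k 0 * b k 0 * 2 - 2 = (b k 0 ^+ 2 - 1) * 2 by ring.
rewrite mulf_eq0 pnatr_eq0 orbF subr_eq0 sqrf_eq1 => /orP[]/eqP // bkN.
by have := nn_b k; rewrite bkN ler0N1.
Qed.

Lemma nneg_reflection t : t \in T -> exists x i,
  [/\ x \in W, nneg (rho x *m sroot R i) & t = (x * g i * x^-1)%g].
Proof.
case/reflectionsP=> x [i [Wx ->]]; have [nn_x|np_x] := root_sign i Wx.
  by exists x, i.
exists (x * g i)%g, i; split; first exact: groupM.
  by rewrite rhoMv // rho_root_g mulmxN; exact: np_x.
by rewrite invMg !mulgA mulgK.
Qed.

Lemma parabolic_root x i i0 : x \in W -> (rho x *m sroot R i) i0 0 = 0 ->
  (x * g i * x^-1)%g \in reflections <<S :\ g i0>>%g (S :\ g i0).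
Proof.
pose J := S :\ g i0; rewrite -/J => Wx x0.
wlog nn_x : x Wx x0 / nneg (rho x *m sroot R i).
  move=> IH; have [|np] := root_sign i Wx; first exact: IH.
  have -> : (x * g i * x^-1 = (x * g i) * g i * (x * g i)^-1)%g.
    by rewrite invMg !mulgA mulgK.
  apply: IH; rewrite ?groupM // rhoMv // rho_root_g mulmxN; last exact: np.
  by rewrite mxE x0 oppr0.
(* Induction on the height of the root, lowered by a simple reflection of [J]. *)
pose ht (p : gT * 'I_n.+1) := \sum_k (rho p.1 *m sroot R p.2) k 0.
(* Heights are real numbers; counting the pairs of smaller height gives a natural number on which to
   induct. *)
pose below p := #|[set q : gT * 'I_n.+1 | (q.1 \in W) && (ht q < ht p)]|.
elim/ltn_ind: {x}(below (x, i)) {-2}x (erefl (below (x, i))) Wx x0 nn_x => p IHp x.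
move=> def_p Wx x0 nn_x; set b := rho x *m _ in x0 nn_x.
(* These products sum to the norm 2. A positive one has both factors positive, so [k] differs from
   [i0] and reflecting in [g k] lowers the height. *)
have [k bk_gt0] : exists k, 0 < b k 0 * (C *m b) k 0.
  apply/existsP; apply: contraT => /existsPn le0.
  have : dot b (C *m b) <= 0 by rewrite dotE sumr_le0 // => k _; rewrite leNgt.
  by rewrite root_norm // leNgt ltr0n.
have bk : 0 < b k 0.
  by rewrite lt_def nn_x andbT; apply: contraTneq bk_gt0 => ->; rewrite mul0r ltxx.
have Cbk : 0 < (C *m b) k 0 by rewrite -(pmulr_rgt0 _ bk).
have ki0 : k != i0 by apply: contraTneq bk => ->; rewrite x0 ltxx.
have Jk : g k \in J by rewrite !inE gS (inj_eq g_inj) ki0.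
have Wy : (g k * x)%g \in W by rewrite groupM.
have yE : rho (g k * x)%g *m sroot R i = b - (C *m b) k 0 *: sroot R k.
  by rewrite rhoMv // rho_g refl_mxE.
have yj j : (rho (g k * x)%g *m sroot R i) j 0 = b j 0 - (C *m b) k 0 * (j == k)%:R.
  by rewrite yE mxE [X in _ + X]mxE [X in - X]mxE srootE.
have [nn_y|np_y] := root_sign i Wy.
  have TJ : (g k * x * g i * (g k * x)^-1)%g \in reflections <<J>>%g J.
    apply: (IHp (below (g k * x, i)%g)) => //; last first.
      by rewrite yj x0 eq_sym (negPf ki0) mulr0 subr0.
    have ht_y : ht (g k * x, i)%g < ht (x, i).
      rewrite /ht /= -/b (bigD1 k) //= [ltRHS](bigD1 k) //=.
      rewrite ltr_leD //; first by rewrite yj eqxx mulr1 gtrDl oppr_lt0.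
      by apply: ler_sum => j /negPf njk; rewrite yj njk mulr0 subr0.
    rewrite -def_p; apply: proper_card; apply/properP; split.
      apply/subsetP => q; rewrite !inE => /andP[-> lt_q].
      exact: lt_trans lt_q ht_y.
    by exists (g k * x, i)%g; rewrite !inE /= ?Wy ?ltxx.
  have -> : (x * g i * x^-1 = (g k * x * g i * (g k * x)^-1) ^ g k)%g.
    by rewrite conjgE invMg !gV !mulgA gK mul1g -mulgA gK mulg1.
  case/imset2P: TJ => s z Js Jz ->; rewrite -conjgM.
  by apply: imset2_f; rewrite // groupM // mem_gen.
have -> : (x * g i * x^-1 = 1 * g k * 1^-1)%g.
  by apply/reflection_eq => //; left; rewrite rho1 mul1mx; apply: nneg_refl_npos.
by rewrite mul1g invg1 mulg1 -[g k]conjg1; apply: imset2_f; rewrite ?group1.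
Qed.

Lemma gprod_cons i a : gprod (i :: a) = (g i * gprod a)%g.
Proof. exact: big_cons. Qed.

Lemma reflectionsJ x : x \in W -> (T :^ x = T)%g.
Proof.
move=> Wx; apply/eqP; rewrite eqEcard cardJg leqnn andbT; apply/subsetP => t.
rewrite mem_conjg => /imset2P[s z Ss Wz /(canRL (conjgKV _))->].
by rewrite -conjgM; apply: imset2_f => //; apply: groupM.
Qed.

Lemma gprod_cat (a b : seq 'I_n.+1) : gprod (a ++ b) = (gprod a * gprod b)%g.
Proof. exact: big_cat. Qed.

Lemma gprod_rem i (a : seq 'I_n.+1) : i \in a ->
    {in a &, forall j k, commute (g j) (g k)} ->
  (g i * gprod a)%g = gprod (rem i a).
Proof.
elim: a => // j a IHa + comm_a; rewrite inE eq_sym /= gprod_cons.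
have [<-|nji] := eqVneq j i; first by rewrite mulgA gK mul1g.
move=> /= ia; rewrite gprod_cons -IHa // => [|k l ka la].
  have cij : commute (g i) (g j) by apply: comm_a; rewrite inE ?eqxx ?ia ?orbT.
  by rewrite !mulgA cij.
by apply: comm_a; rewrite inE ?ka ?la orbT.
Qed.

Definition adj : rel 'I_n.+1 := [rel i j | (i != j) && (C i j != 0)].

Lemma adj_forest : forest adj.
Proof.
exact: (posdef_forest (fun v => @cartan_posdef v) Cii
                      (fun i j => @cartan_offdiag i j)).
Qed.

Lemma conj_words_gprod (a b : seq 'I_n.+1) : conj_words adj a b ->
  exists2 x, x \in W & gprod b = (gprod a ^ x)%g.
Proof.
elim=> {a b} [a|a b _ [x Wx ->]|a b c _ [x Wx ->] _ [y Wy ->]|a i j b nij|i a].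
- by exists 1%g; rewrite ?conjg1.
- by exists x^-1%g; rewrite ?groupV ?conjgK.
- by exists (x * y)%g; rewrite ?groupM ?conjgM.
- exists 1%g; rewrite // conjg1 !gprod_cat !gprod_cons; congr (_ * _)%g.
  rewrite !mulgA; congr (_ * _)%g; have [->//|neq_ij] := eqVneq i j.
  apply: cartan0_commute; apply: contraNeq nij => Cij.
  by rewrite /adj /= neq_ij Csym.
exists (g i); rewrite // -cats1 gprod_cat !gprod_cons.
by rewrite /gprod big_nil mulg1 conjgE !mulgA gV gK mul1g.
Qed.

Lemma gprod_conj (a b : seq 'I_n.+1) : uniq a -> perm_eq a b ->
  exists2 x, x \in W & gprod b = (gprod a ^ x)%g.
Proof.
by move=> Ua pab; apply/conj_words_gprod/forest_conj_words => //; apply: adj_forest.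
Qed.

(** Reflections in pairwise orthogonal roots do not disturb one another's coefficients, so their
    corrections add up. *)
Lemma rho_gprod_mx a : uniq a ->
    (forall i j, i \in a -> j \in a -> i != j -> C i j = 0) ->
  rho (gprod a) = \matrix_(i, j) ((i == j)%:R - (i \in a)%:R * C i j).
Proof.
elim: a => [|i a IHa] /= Ua aC0.
  rewrite /gprod big_nil rho1; apply/matrixP => i j.
  by rewrite !mxE mul0r subr0.
have /andP[ia Ua'] := Ua.
have aC0' : forall i j, i \in a -> j \in a -> i != j -> C i j = 0.
  by move=> k j ka ja; apply: aC0; rewrite inE ?ka ?ja orbT.
rewrite gprod_cons rhoM // IHa // rho_g.
have Cia k : k \in a -> C i k = 0.
  move=> ka; apply: aC0; rewrite ?mem_head ?inE ?ka ?orbT //.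
  by apply: contraNneq ia => ->.
have key j : \sum_k C i k * ((k == j)%:R - (k \in a)%:R * C k j) = C i j.
  rewrite (bigD1 j) //= eqxx big1 ?addr0 => [|k /negPf->].
    by case: (boolP (j \in a)) => [/Cia->|_]; rewrite ?mul0r ?subr0 ?mulr1.
  by case: (boolP (k \in a)) => [/Cia->|_]; rewrite ?mul0r ?subr0 ?mulr0.
apply/matrixP => k j; rewrite [LHS]mxE [RHS]mxE.
transitivity (\sum_l ((k == l)%:R * ((l == j)%:R - (l \in a)%:R * C l j)
   - (k == i)%:R * (C i l * ((l == j)%:R - (l \in a)%:R * C l j)))).
  by apply: eq_bigr => l _; rewrite refl_mx_entry [X in _ * X = _]mxE; ring.
rewrite sumrB -mulr_sumr key (bigD1 k) //= eqxx mul1r big1 ?addr0; last first.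
  by move=> l /negPf nlk; rewrite eq_sym nlk mul0r.
rewrite inE; have [->|nki] := eqVneq k i; rewrite /= ?mul0r ?subr0 //.
by rewrite (negPf ia) mul0r subr0.
Qed.

(** * Bipartite Coxeter elements *)

Section Colouring.
Variable hue : 'I_n.+1 -> bool.
Hypothesis hueP : forall i j, i != j -> C i j != 0 -> hue i != hue j.

Lemma hue_eq0 i j : i != j -> hue i = hue j -> C i j = 0.
Proof. by move=> nij cij; apply: contraTeq isT => /(hueP nij); rewrite cij eqxx. Qed.

Let cw e := [seq i <- enum 'I_n.+1 | hue i == e].

Let comm_cw e : {in cw e &, forall i j, commute (g i) (g j)}.
Proof.
move=> i j; rewrite !mem_filter => /andP[/eqP ci _] /andP[/eqP cj _].
have [->|nij] := eqVneq i j; first by [].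
by apply: cartan0_commute; apply: hue_eq0; rewrite ?ci.
Qed.

Definition cgen (e : bool) := gprod (cw e).

Lemma cgenW e : cgen e \in W.
Proof. exact: gprodW. Qed.
Hint Resolve cgenW : core.

Lemma rho_cgen e : rho (cgen e) =
  \matrix_(i, j) ((i == j)%:R - (hue i == e)%:R * C i j).
Proof.
rewrite /cgen rho_gprod_mx; first 1 last.
- exact/filter_uniq/enum_uniq.
- move=> i j; rewrite !mem_filter => /andP[/eqP ci _] /andP[/eqP cj _] nij.
  by apply: hue_eq0; rewrite ?ci.
by apply/matrixP => i j; rewrite !mxE mem_filter mem_enum andbT.
Qed.

Lemma rho_cgenE e v i :
  (rho (cgen e) *m v) i 0 = if hue i == e then v i 0 - (C *m v) i 0 else v i 0.
Proof.
rewrite rho_cgen mxE.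
transitivity (\sum_j ((i == j)%:R * v j 0 - (hue i == e)%:R * (C i j * v j 0))).
  by apply: eq_bigr => j _; rewrite mxE; ring.
rewrite sumrB -mulr_sumr (bigD1 i) //= eqxx mul1r big1 ?addr0; last first.
  by move=> j /negPf nji; rewrite eq_sym nji mul0r.
rewrite [in LHS](_ : \sum_j _ = (C *m v) i 0) ?mxE //.
by case: eqP => _; rewrite ?mul1r ?mul0r ?subr0.
Qed.

Lemma row_cgen e (q : 'rV[R]_n.+1) j :
  (q *m rho (cgen e)) 0 j = q 0 j - \sum_(i | hue i == e) q 0 i * C i j.
Proof.
rewrite rho_cgen mxE.
transitivity (\sum_i (q 0 i * (i == j)%:R - (if hue i == e then q 0 i * C i j else 0))).
  by apply: eq_bigr => i _; rewrite mxE; case: (hue i == e); rewrite ?mul1r ?mul0r; ring.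
rewrite sumrB -big_mkcond; congr (_ - _).
rewrite (bigD1 j) //= eqxx mulr1 big1 ?addr0 // => i /negPf nij.
by rewrite nij mulr0.
Qed.

Definition cox := (cgen false * cgen true)%g.

(* The elements x_l, with c_+ = [cgen false] and c_- = [cgen true]. *)
Fixpoint lev (l : nat) : gT := if l is l1.+1 then (lev l1 * cgen (odd l1))%g else 1%g.

Lemma levW l : lev l \in W.
Proof. by elim: l => [|l IHl] /=; rewrite ?group1 ?groupM. Qed.
Hint Resolve levW : core.

Lemma lev_double l : lev (l + l) = (cox ^+ l)%g.
Proof.
elim: l => // l IHl; rewrite addSn addnS /= IHl expgSr oddD addbb /=.
by rewrite mulgA.
Qed.

Lemma cgenK e : (cgen e * cgen e = 1)%g.
Proof.
rewrite /cgen; have := @comm_cw e; move: (cw e) => a comm_a.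
elim: a comm_a => [|i a IHa] comm_a; first by rewrite /gprod big_nil mulg1.
have ci : commute (g i) (gprod a).
  rewrite /gprod big_seq; elim/big_ind: _ => [|x y cx cy|j ja].
  - exact: commute1.
  - exact: commuteM.
  - by apply: comm_a; rewrite inE ?eqxx ?ja ?orbT.
rewrite gprod_cons -mulgA (mulgA (gprod a)) -ci -(mulgA (g i)) IHa.
  by rewrite mulg1 gK.
by move=> j k ja ka; apply: comm_a; rewrite inE ?ja ?ka orbT.
Qed.

Lemma cgenV e : (cgen e)^-1%g = cgen e.
Proof. by apply/eqP; rewrite eq_invg_mul cgenK. Qed.

Lemma cgen_neq1 i : cgen (hue i) != 1%g.
Proof.
apply/eqP => c1; have := rho_cgenE (hue i) (sroot R i) i.
rewrite c1 rho1 mul1mx eqxx mulmx_sroot Cii srootE eqxx; lra.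
Qed.

(** * Signs along the levels *)

Variables (mu : R) (d : 'cV[R]_n.+1).
Hypotheses (d_gt0 : forall i, 0 < d i 0) (Cd : C *m d = mu *: d).

(** The row [d^T *m rho (lev l)] is a multiple of [d^T] on each colour class; the first component is
    the multiple on the class of the next factor. Applying that factor negates this class and adds
    [2 - mu] times its multiple to the other, because the off-diagonal part of [C] exchanges the
    classes and has eigenvalue [mu - 2] at [d]. *)
Fixpoint lev_coef (l : nat) : R * R :=
  if l is l1.+1
  then ((2 - mu) * (lev_coef l1).1 + (lev_coef l1).2, - (lev_coef l1).1)
  else (1, 1).

Lemma row_lev l j :
  (d^T *m rho (lev l)) 0 j
    = (if hue j == odd l then (lev_coef l).1 else (lev_coef l).2) * d j 0.
Proof.
elim: l j => [|l IHl] j.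
  by rewrite /= rho1 mulmx1 mxE if_same mul1r.
rewrite [lev _]/= rhoM // mulmxA row_cgen IHl.
under eq_bigr => i /eqP hi do rewrite IHl hi eqxx -mulrA.
rewrite -mulr_sumr /=; set a := (lev_coef l).1; set b := (lev_coef l).2.
have sumC : \sum_i d i 0 * C i j = mu * d j 0.
  have := congr1 (fun v : 'cV[R]_n.+1 => v j 0) Cd; rewrite [RHS]mxE => <-.
  by rewrite mxE; apply: eq_bigr => i _; rewrite mulrC Csym.
have [hj|hj] := eqVneq (hue j) (odd l).
  rewrite (bigD1 j) ?hj //= big1 ?addr0 => [|i /andP[/eqP hi nij]]; last first.
    by rewrite (hue_eq0 nij) ?mulr0 // hi.
  have -> : (odd l == ~~ odd l) = false by case: (odd l).
  by rewrite Cii; ring.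
have -> : hue j == ~~ odd l by move: hj; case: (hue j); case: (odd l).
have -> : \sum_(i | hue i == odd l) d i 0 * C i j = (mu - 2) * d j 0.
  rewrite mulrBl -sumC [in RHS](bigID (fun i => hue i == odd l)) /=.
  rewrite [X in _ + X - _](bigD1 j) //= Cii [X in _ + (_ + X)]big1 => [|i /andP[hi nij]].
    by ring.
  rewrite (hue_eq0 nij) ?mulr0 //.
  by move: hi hj; case: (hue i); case: (hue j); case: (odd l).
by ring.
Qed.

Lemma row_rho_dot w i : (d^T *m rho w) 0 i = dot d (rho w *m sroot R i).
Proof. by rewrite /dot mulmxA -colE [RHS]mxE. Qed.

(** Strictness comes from roots being nonzero. Together with [npos_dot], the sign of the functional
    decides the sign of the root. *)
Lemma nneg_dot w i : w \in W -> nneg (rho w *m sroot R i) ->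
  0 < (d^T *m rho w) 0 i.
Proof.
move=> Ww nn; rewrite row_rho_dot dotE lt_def sumr_ge0 ?andbT => [|k _].
  2: by rewrite mulr_ge0 ?nn // ltW.
apply/negP => /eqP/psumr_eq0P d0; have /negP[] := root_neq0 i Ww.
apply/eqP/colP => k; rewrite [RHS]mxE; apply: (mulfI (lt0r_neq0 (d_gt0 k))).
by rewrite mulr0 d0 // => l _; rewrite mulr_ge0 ?nn // ltW.
Qed.

Lemma npos_dot w i : w \in W -> npos (rho w *m sroot R i) ->
  (d^T *m rho w) 0 i < 0.
Proof.
move=> Ww np; have Wwi := groupM Ww (gW i).
have wi : rho (w * g i)%g *m sroot R i = - (rho w *m sroot R i).
  by rewrite rhoMv // rho_root_g mulmxN.
have := @nneg_dot _ i Wwi; rewrite row_rho_dot wi dotNr oppr_gt0 -row_rho_dot.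
exact.
Qed.

Definition sgn_coef l i := if hue i == odd l then (lev_coef l).1 else (lev_coef l).2.

Lemma lev_nneg l i : 0 < sgn_coef l i -> nneg (rho (lev l) *m sroot R i).
Proof.
move=> c_gt0; have [//|np] := root_sign i (levW l).
have := npos_dot (levW l) np; rewrite row_lev -/(sgn_coef l i).
by rewrite ltNge mulr_ge0 // ltW.
Qed.

Lemma lev_npos l i : sgn_coef l i < 0 -> npos (rho (lev l) *m sroot R i).
Proof.
move=> c_lt0; have [nn|//] := root_sign i (levW l).
have := nneg_dot (levW l) nn; rewrite row_lev -/(sgn_coef l i).
by rewrite ltNge mulr_le0_ge0 // ltW.
Qed.

Lemma lev1_gt0 l i : lev l = 1%g -> 0 < sgn_coef l i.
Proof.
move=> l1; have := row_lev l i; rewrite l1 rho1 mulmx1 mxE => def_d.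
by rewrite -(pmulr_lgt0 _ (d_gt0 i)) -def_d.
Qed.

Hypothesis hue_onto : forall e, exists i, hue i = e.

Lemma ab1_neq0 l : (lev_coef l).1 != 0.
Proof.
have [i hi] := hue_onto (odd l); apply/eqP => a0.
have := row_lev l i; rewrite hi eqxx a0 mul0r => q0.
have [/(nneg_dot (levW l))|/(npos_dot (levW l))] := root_sign i (levW l).
  by rewrite q0 ltxx.
by rewrite q0 ltxx.
Qed.

Local Notation h := #[cox]%g.

(** For odd [l], triviality would make [cgen false] a power of [cox], so the two factors commute and
    [h <= 2]. What remains is that one of them is trivial, impossible since both colours occur. *)
Lemma lev_neq1 l : (0 < l)%N -> (l < h + h)%N -> lev l != 1%g.
Proof.
move=> l_gt0 lt_lh; have [odd_l|even_l] := boolP (odd l); last first.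
  have def_l : l = (l./2 + l./2)%N by rewrite addnn even_halfK.
  rewrite def_l lev_double -order_dvdn gtnNdvd //; lia.
have def_l : l = (l./2 + l./2).+1 by rewrite addnn -[in LHS](odd_double_half l) odd_l.
rewrite def_l /= lev_double addnn odd_double.
apply/eqP => cf; have comm_c : commute cox (cgen false).
  move/(canRL (mulKg _)): cf; rewrite mulg1 => ->.
  exact/commuteV/commuteX.
have comm_ft : (cgen false * cgen true = cgen true * cgen false)%g.
  have := comm_c; rewrite /commute /cox !mulgA cgenK mul1g => eq_c.
  by rewrite -{2}eq_c -!mulgA cgenK mulg1.
have c2 : (cox ^+ 2 = 1)%g.
  by rewrite expgS expg1 {2}/cox comm_ft /cox mulgA -(mulgA (cgen false)) cgenK mulg1 cgenK.
have lt_h : (h <= 2)%N by rewrite dvdn_leq // order_dvdn c2.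
have [[i hi] [j hj]] := (hue_onto false, hue_onto true).
have : (l./2 <= 1)%N by lia.
case: (l./2) cf => [|[|//]] cf _.
  by have := cgen_neq1 i; rewrite hi -cf expg0 mul1g eqxx.
by have := cgen_neq1 j; rewrite hj -cf expg1 /cox comm_ft -mulgA cgenK mulg1 eqxx.
Qed.

(** The second coefficient at a level is minus the first one at the level before. A change from
    negative to positive would make both positive, hence [lev l = 1], which is excluded; the return
    to 1 at [h + h] forces a negative last value. At the first negative level both coefficients are
    negative. *)
Lemma lev_phases : exists2 m, (m <= h + h)%N &
  [/\ forall l, (l < m)%N -> 0 < (lev_coef l).1,
      forall l, (m <= l < h + h)%N -> (lev_coef l).1 < 0
    & forall i, npos (rho (lev m) *m sroot R i)].
Proof.
have h_gt0 : (0 < h)%N := order_gt0 _.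
have b_S l : (lev_coef l.+1).2 = - (lev_coef l).1 by [].
have last_neg : (lev_coef (h + h).-1).1 < 0.
  have [i hi] := hue_onto true.
  have := lev1_gt0 i (etrans (lev_double h) (expg_order cox)).
  rewrite /sgn_coef addnn odd_double hi /= -addnn.
  by rewrite -[in (lev_coef (h + h)).2](prednK (_ : 0 < h + h)%N) ?b_S ?oppr_gt0 //; lia.
have pos_pred l : (0 < l < h + h)%N -> 0 < (lev_coef l).1 -> 0 < (lev_coef l.-1).1.
  case/andP=> l_gt0 lt_l a_gt0; rewrite ltNge; apply/negP => a_le0.
  have /negP[] := lev_neq1 l_gt0 lt_l; apply/eqP/roots_nneg_eq1 => // i.
  apply: lev_nneg; rewrite /sgn_coef; case: ifP => // _.
  by rewrite -(prednK l_gt0) b_S oppr_gt0 lt_neqAle a_le0 ab1_neq0.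
have ex_neg : exists l, (lev_coef l).1 < 0 by exists (h + h).-1.
have [m am_lt0 minm] := ex_minnP ex_neg.
have m_gt0 : (0 < m)%N by case: m am_lt0 {minm} => //=; rewrite ltr10.
have le_m : (m <= (h + h).-1)%N := minm _ last_neg.
have pos_lt l : (l < m)%N -> 0 < (lev_coef l).1.
  move=> lt_lm; rewrite lt_neqAle eq_sym ab1_neq0 leNgt.
  by apply/negP => /minm; rewrite leqNgt lt_lm.
exists m; first by lia.
split=> // [l|i].
  case/andP=> le_ml lt_l; rewrite -(subnKC le_ml).
  have : (m + (l - m) < h + h)%N by rewrite subnKC.
  elim: (l - m)%N => [|p IHp] lt_p; first by rewrite addn0.
  rewrite ltNge; apply/negP => a_ge0.
  have ab_gt0 : 0 < (lev_coef (m + p.+1)).1 by rewrite lt_neqAle eq_sym ab1_neq0.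
  have lt_p0 : (0 < m + p.+1 < h + h)%N by rewrite lt_p addnS.
  have := pos_pred _ lt_p0 ab_gt0; rewrite (addnS m) -pred_Sn ltNge ltW // IHp //.
  by rewrite (leq_trans _ lt_p) // addnS.
apply: lev_npos; rewrite /sgn_coef; case: ifP => // _.
by rewrite -(prednK m_gt0) b_S oppr_lt0 pos_lt // prednK.
Qed.

Lemma cgen_root i : rho (cgen (hue i)) *m sroot R i = - sroot R i.
Proof.
apply/colP => k; rewrite rho_cgenE (mulmx_sroot C) [RHS]mxE !srootE.
have [->|nki] := eqVneq k i; first by rewrite !eqxx Cii -[true%:R]/1; lra.
by case: eqP => [hk|_]; rewrite ?(hue_eq0 nki hk) ?subr0 oppr0.
Qed.

(** [cgen e] changes only coordinates of colour [e], so the root is supported there. Its support is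
    then orthogonal, and a single [g i] already negates a nonzero coordinate. *)
Lemma hue_flip z p e : z \in W -> nneg (rho z *m sroot R p) ->
    npos (rho (cgen e * z)%g *m sroot R p) ->
  exists2 i, hue i = e & rho z *m sroot R p = sroot R i.
Proof.
move=> Wz; rewrite rhoMv //; have := root_neq0 p Wz.
have flip k := @nneg_refl_npos z p k Wz.
set v := rho z *m _ in flip *; move=> v0 nn_v np_v.
have v_off k : hue k != e -> v k 0 = 0.
  move=> hk; apply/eqP; rewrite eq_le nn_v andbT.
  by have := np_v k; rewrite mxE rho_cgenE (negPf hk) oppr_ge0.
have [i vi] : exists i, v i 0 != 0.
  by apply/existsP; apply: contraNT v0 => /existsPn v0; apply/eqP/colP => k;
     rewrite [RHS]mxE; apply/eqP/negPn/v0.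
have hi : hue i = e by apply/eqP; apply: contraNT vi => /v_off->.
exists i => //; apply: flip => //.
have [nn_i|//] := root_sign p (groupM (gW i) Wz).
have := nn_i i; rewrite rhoMv // -/v rho_g refl_mxE mxE [X in _ + X]mxE.
rewrite [X in _ - X]mxE srootE eqxx mulr1.
have -> : (C *m v) i 0 = v i 0 *+ 2.
  rewrite mxE (bigD1 i) //= Cii mulr2n big1 ?addr0 => [|k nki]; first by ring.
  have [hk|hk] := eqVneq (hue k) e; last by rewrite v_off ?mulr0.
  by rewrite hue_eq0 ?mul0r ?hi // eq_sym.
rewrite mulr2n opprD addrA subrr sub0r oppr_ge0 => v_le0.
by case/eqP: vi; apply/eqP; rewrite eq_le v_le0 nn_v.
Qed.

(** * Crossings of the hyperplane of a fixed reflection *)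

Section LevelCount.
Variables (y : gT) (p : 'I_n.+1).
Hypotheses (Wy : y \in W) (nn_y : nneg (rho y *m sroot R p)).

(** Geometrically, the chamber of [lev l] lies on the positive side of the hyperplane of the
    positive root [rho y *m sroot R p]. *)
Let above l := `[< nneg (rho ((lev l)^-1 * y)%g *m sroot R p) >].
Let hits l := [set i | (hue i == odd l)
                 && (lev l * g i * (lev l)^-1 == y * g p * y^-1)%g].

Let hitsP l i : reflect (hue i = odd l /\
    (rho ((lev l)^-1 * y)%g *m sroot R p = sroot R i
     \/ rho ((lev l)^-1 * y)%g *m sroot R p = - sroot R i))
  (i \in hits l).
Proof.
have Wz : ((lev l)^-1 * y)%g \in W by rewrite groupM ?groupV.
have zE : (((lev l)^-1 * y) * g p * ((lev l)^-1 * y)^-1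
    = (y * g p * y^-1) ^ lev l)%g by rewrite conjgE invMg invgK !mulgA.
have reflE := @reflection_eq ((lev l)^-1 * y)%g p 1%g i Wz (group1 W).
rewrite zE mul1g invg1 mulg1 rho1 mul1mx in reflE.
rewrite inE; apply: (iffP andP) => [[/eqP hi /eqP eq_t]|[hi /reflE eq_z]]; split=> //.
- by apply/reflE; rewrite -eq_t conjgE !mulgA mulVg mul1g mulgKV.
- exact/eqP.
by rewrite -eq_z conjgE !mulgA mulgV mul1g mulgK.
Qed.

Let above_next l : ((lev l.+1)^-1 * y = cgen (odd l) * ((lev l)^-1 * y))%g.
Proof. by rewrite /= invMg cgenV mulgA. Qed.

(** By [hue_flip] the side changes exactly when there is a hit, and then only one. On a hit the
    fixed root is plus or minus the root at level [l]; since it is positive, the phase decides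
    which, and so the direction of crossing. *)
Let hits_step l :
  if 0 < (lev_coef l).1 then (#|hits l| + above l.+1 = above l)%N
  else (#|hits l| + above l = above l.+1)%N.
Proof.
rewrite /above above_next.
set z := ((lev l)^-1 * y)%g; have Wz : z \in W by rewrite groupM ?groupV.
have Wcz : (cgen (odd l) * z)%g \in W by rewrite groupM.
have not_both v : v != 0 -> nneg v -> npos v -> False.
  by move=> /eqP v0 nn np; apply/v0/nneg_npos.
have [hits0|[i hit_i]] := set_0Vmem (hits l).
  suff -> : `[< nneg (rho (cgen (odd l) * z)%g *m sroot R p) >]
              = `[< nneg (rho z *m sroot R p) >].
    by rewrite hits0 cards0 add0n; case: ifP.
  apply/asboolP/asboolP => [nn_cz|nn_z].
    have [//|np_z] := root_sign p Wz.
    have Wzp : (z * g p)%g \in W by rewrite groupM.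
    have zpE : rho (z * g p)%g *m sroot R p = - (rho z *m sroot R p).
      by rewrite rhoMv // rho_root_g mulmxN.
    have [||i hi] := @hue_flip (z * g p)%g p (odd l) Wzp.
    - by rewrite zpE; exact: np_z.
    - by rewrite rhoMv // zpE mulmxN -rhoMv // /npos opprK.
    rewrite zpE => /(canRL opprK) zE.
    have : i \in hits l by apply/hitsP; split=> //; right.
    by rewrite hits0 inE.
  have [//|np_cz] := root_sign p Wcz.
  have [i hi zE] := hue_flip Wz nn_z np_cz.
  have : i \in hits l by apply/hitsP; split=> //; left.
  by rewrite hits0 inE.
have [hi zE] := hitsP _ _ hit_i; rewrite -/z in zE.
have -> : hits l = [set i].
  apply/setP => j; rewrite inE; apply/idP/eqP => [|->//].
  case/hitsP=> hj; rewrite -/z => zE'; apply/eqP; apply: contraT => nji.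
  have : (rho z *m sroot R p) i 0 = 0.
    by case: zE' => ->; last rewrite mxE; rewrite srootE eq_sym (negPf nji) ?oppr0.
  by case: zE => ->; last rewrite mxE; rewrite srootE eqxx => /eqP;
     rewrite ?oppr_eq0 oner_eq0.
have nn_i : nneg (sroot R i) by move=> k; rewrite srootE ler0n.
have i0 : sroot R i != 0.
  by apply/eqP => /colP/(_ i)/eqP; rewrite srootE eqxx mxE oner_eq0.
have czE : rho (cgen (odd l) * z)%g *m sroot R p = - (rho z *m sroot R p).
  by rewrite rhoMv //; case: zE => ->; rewrite -hi ?mulmxN cgen_root.
have yE : rho y *m sroot R p = rho (lev l) *m (rho z *m sroot R p).
  by rewrite -rhoMv // /z mulKVg.
have ci : sgn_coef l i = (lev_coef l).1 by rewrite /sgn_coef hi eqxx.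
have li0 := root_neq0 i (levW l).
have nT : `[< nneg (sroot R i) >] by apply: asboolT.
have nF : `[< nneg (- sroot R i) >] = false by apply/asboolF/(not_both _ i0).
rewrite cards1 czE; case: ifP => [a_gt0|/negbT].
  have nn_li := @lev_nneg l i; rewrite ci in nn_li.
  case: zE => zE; last first.
    exfalso; apply: (not_both _ li0 (nn_li a_gt0)).
    by rewrite /npos -mulmxN -zE -yE.
  by rewrite zE nT nF.
rewrite -leNgt le_eqVlt (negPf (ab1_neq0 l)) /= => a_lt0.
have np_li := @lev_npos l i; rewrite ci in np_li.
case: zE => zE.
  exfalso; apply: (not_both _ li0 _ (np_li a_lt0)).
  by rewrite -zE -yE.
by rewrite zE opprK nT nF.
Qed.

Lemma level_count : (\sum_(l < h + h) #|hits l| = 2)%N.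
Proof.
have [m le_m [pos neg np_m]] := lev_phases.
have above0 : above 0%N by apply/asboolP; rewrite invg1 mul1g.
have above2h : above (h + h)%N.
  by apply/asboolP; rewrite lev_double expg_order invg1 mul1g.
(* [lev m] sends every simple root, hence every nonnegative vector, to a nonpositive one, whereas
   the fixed root is positive. *)
have above_m : above m = false.
  apply/asboolP => nn_m; have /eqP[] := root_neq0 p Wy; apply: nneg_npos => // k.
  rewrite -(mulKVg (lev m) y) rhoMv ?groupM ?groupV // mxE [X in - X]mxE.
  rewrite -sumrN sumr_ge0 // => i _; rewrite -mulNr mulr_ge0 //.
  by have := np_m i k; rewrite mxE mulmx_sroot.
have up l : (l <= m)%N -> (\sum_(i < l) #|hits i| + above l = 1)%N.
  elim: l => [|l IHl] lt_lm; first by rewrite big_ord0 above0.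
  rewrite big_ord_recr /= -addnA; have := hits_step l; rewrite pos // => ->.
  exact/IHl/ltnW.
have down l : (m <= l <= h + h)%N -> (\sum_(i < l) #|hits i| = 1 + above l)%N.
  case/andP; elim: l => [|l IHl] le_ml lt_l.
    have m0 : m = 0%N by apply/eqP; rewrite -leqn0.
    by rewrite m0 above0 in above_m.
  move: le_ml; rewrite leq_eqVlt => /predU1P[<-|lt_ml].
    by rewrite above_m addn0 -(up m) // above_m addn0.
  have al : (lev_coef l).1 < 0 by apply: neg; rewrite -ltnS lt_ml.
  rewrite big_ord_recr /= IHl // ?(ltnW lt_l) //; have := hits_step l.
  by rewrite ltNge ltW //= => <-; lia.
by rewrite down ?above2h // leqnn le_m.
Qed.

End LevelCount.

Definition cox_word := cw false ++ cw true.

Lemma cox_gprod : cox = gprod cox_word.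
Proof. by rewrite gprod_cat. Qed.

Lemma cox_word_perm : perm_eq cox_word (enum 'I_n.+1).
Proof.
rewrite perm_catC perm_sym.
have -> : cw false = [seq i <- enum 'I_n.+1 | predC [pred i | hue i == true] i].
  by apply: eq_filter => i /=; case: (hue i).
by rewrite perm_sym; apply/permPl/perm_filterC.
Qed.

(** Powers of [cox] centralize [cox], so up to conjugation the level is 0 or 1. There [g i] cancels
    against its own occurrence in the commuting product of its colour. *)
Lemma level_reflection l i : hue i = odd l ->
  exists a x, [/\ x \in W, perm_eq (i :: a) (enum 'I_n.+1)
    & ((lev l * g i * (lev l)^-1)^-1 * cox = gprod a ^ x)%g].
Proof.
move=> hi; set p := l./2.
have i_cw : i \in cw (odd l) by rewrite mem_filter hi eqxx mem_enum.
have Wx : (cox ^- p)%g \in W by rewrite groupV groupX // groupM ?cgenW.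
have conj_c u : ((cox ^+ p * u * g i * (cox ^+ p * u)^-1)^-1 * cox
    = ((u * g i * u^-1)^-1 * cox) ^ (cox ^- p))%g.
  have cc : (cox = cox ^ (cox ^- p))%g.
    by apply/esym/conjg_fixP/commgP/commuteV/commuteX.
  rewrite conjMg -cc conjVg; congr (_^-1 * _)%g.
  by rewrite conjgE invgK invMg !mulgA.
have [odd_l|even_l] := boolP (odd l); rewrite ?odd_l ?(negPf even_l) in i_cw hi.
  exists (cw false ++ rem i (cw true)), (cox ^- p)%g; split=> //.
    apply: perm_trans cox_word_perm; rewrite /cox_word -cat1s perm_catCA perm_cat2l.
    by rewrite perm_sym perm_to_rem.
  have -> : lev l = (cox ^+ p * cgen false)%g.
    by rewrite -[l]odd_double_half odd_l add1n -addnn /= lev_double addnn odd_double.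
  rewrite conj_c gprod_cat -(gprod_rem i_cw (@comm_cw _)).
  by rewrite !invMg invgK gV !mulgA mulgKV.
exists (rem i (cw false) ++ cw true), (cox ^- p)%g; split=> //.
  apply: perm_trans cox_word_perm; rewrite /cox_word -cat_cons perm_cat2r.
  by rewrite perm_sym perm_to_rem.
have -> : lev l = (cox ^+ p * 1)%g.
  by rewrite -[l]odd_double_half (negPf even_l) add0n -addnn lev_double mulg1.
rewrite conj_c gprod_cat -(gprod_rem i_cw (@comm_cw _)).
by rewrite mul1g invg1 mulg1 gV mulgA.
Qed.

Lemma level_sum (F : gT -> nat) :
  (\sum_(l < h + h) \sum_(i | hue i == odd l) F (lev l * g i * (lev l)^-1)%g
   = (\sum_(t in T) F t).*2)%N.
Proof.
transitivity (\sum_(l < h + h) \sum_(t in T)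
   #|[set i | (hue i == odd l) && (lev l * g i * (lev l)^-1 == t)%g]| * F t)%N.
  apply: eq_bigr => l _.
  rewrite (partition_big (fun i => (lev l * g i * (lev l)^-1)%g) [in T]) => [|i _] /=.
    apply: eq_bigr => t _; rewrite -sum_nat_const; apply: eq_big => i.
      by rewrite inE.
    by case/andP=> _ /eqP->.
  by apply/reflectionsP; exists (lev l), i.
rewrite exchange_big /= -muln2 big_distrl /=; apply: eq_bigr => t Tt.
rewrite -big_distrl /= mulnC; congr (_ * _)%N.
have [y [p [Wy nn_y ->]]] := nneg_reflection Tt.
exact: (level_count Wy nn_y).
Qed.

Lemma level_sum_const (F : 'I_n.+1 -> nat) m :
  (\sum_(l < m + m) \sum_(i | hue i == odd l) F i = m * \sum_i F i)%N.
Proof.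
have sum_odd (G : bool -> nat) :
    (\sum_(l < m + m) G (odd l) = m * (G false + G true))%N.
  elim: m => [|m IHm]; first by rewrite big_ord0 mul0n.
  by rewrite addSn addnS !big_ord_recr /= IHm addnn odd_double /= -addnA mulSn addnC.
rewrite (sum_odd (fun e => \sum_(i | hue i == e) F i)%N); congr (_ * _)%N.
rewrite [RHS](bigID (fun i => hue i == false)) /=; congr (_ + _)%N.
by apply: eq_bigl => i; case: (hue i).
Qed.

(* Every reflection occurs exactly twice among the [h * n.+1] reflections crossed
   by the word [cox ^+ h], and each of them sends [cox] to a conjugate of the
   product of all generators but one. *)
Lemma sum_reflections (F : gT -> nat) (f : 'I_n.+1 -> nat) :
    (forall w x, x \in W -> F (w ^ x)%g = F w) ->
    (forall i a, perm_eq (i :: a) (enum 'I_n.+1) -> F (gprod a) = f i) ->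
  ((\sum_(t in T) F (t^-1 * cox)%g).*2 = h * \sum_i f i)%N.
Proof.
move=> F_conj F_f.
rewrite -(level_sum (fun t => F (t^-1 * cox)%g)) -level_sum_const.
apply: eq_bigr => l _; apply: eq_bigr => i /eqP hi.
have [a [x [Wx pa ->]]] := level_reflection hi.
by rewrite F_conj //; apply: F_f pa.
Qed.

End Colouring.

(** * Arbitrary Coxeter elements *)

Section Connected.
Hypothesis conn : forall i j, connect [rel i j | C i j != 0] i j.

Lemma colour_onto (hue : 'I_n.+1 -> bool) :
    (forall i j, i != j -> C i j != 0 -> hue i != hue j) -> n != 0%N ->
  forall e, exists i, hue i = e.
Proof.
move=> hueP n_neq0 e; have [i /eqP hi|hue_e] := pickP (fun i => hue i == e); first by exists i.
suff /eqP : (0 : 'I_n.+1) = ord_max by rewrite -val_eqE eq_sym /= (negPf n_neq0).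
have /connectP[p pth ->] := conn 0 ord_max.
elim: p (0 : 'I_n.+1) pth => //= j p IHp i /andP[Cij pth].
have [->|nij] := eqVneq i j; first exact: IHp.
have := hueP i j nij Cij; have := hue_e i; have := hue_e j.
by case: (hue i); case: (hue j); case: (e).
Qed.

(** With one generator a colour class is empty and the phase argument breaks down; both sides are
    evaluated directly, [T] being a single reflection. *)
Lemma sum_reflections_rank1 (F : gT -> nat) (f : 'I_n.+1 -> nat) a :
    n = 0%N -> perm_eq a (enum 'I_n.+1) ->
    (forall i r, perm_eq (i :: r) (enum 'I_n.+1) -> F (gprod r) = f i) ->
  ((\sum_(t in T) F (t^-1 * gprod a)%g).*2 = #[gprod a]%g * \sum_i f i)%N.
Proof.
move=> n0 pa F_f.
have all0 i : i = 0 by apply: val_inj; case: i => i /=; rewrite n0; case: i.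
have p0 : perm_eq [:: 0] (enum 'I_n.+1).
  by apply: uniq_perm; rewrite ?enum_uniq // => i; rewrite mem_enum (all0 i) inE.
have -> : a = [:: 0].
  apply/perm_small_eq => //; apply: perm_trans pa _; rewrite perm_sym; exact: p0.
have -> : gprod [:: 0] = g 0 by rewrite gprod_cons /gprod big_nil mulg1.
have -> : T = [set g 0].
  apply/setP => t; rewrite inE; apply/idP/eqP => [|->]; last exact: gT_refl.
  case/reflectionsP=> x [i [Wx ->]]; rewrite (all0 i).
  suff cx : commute x (g 0) by rewrite cx mulgK.
  elim/W_rev_ind: x / Wx => [|x j _ cx]; first exact/commute_sym/commute1.
  by rewrite (all0 j); apply/commute_sym/commuteM; first exact: commute_sym.
rewrite big_set1 mulVg -muln2 mulnC order_g.
have -> : F 1%g = f 0 by rewrite -(F_f 0 [::]) // /gprod big_nil.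
by rewrite (bigD1 0) //= big1 ?addn0 // => i; rewrite (all0 i) eqxx.
Qed.

Lemma sum_coxeter_reflections (F : gT -> nat) (f : 'I_n.+1 -> nat) a :
    perm_eq a (enum 'I_n.+1) ->
    (forall w x, x \in W -> F (w ^ x)%g = F w) ->
    (forall i r, perm_eq (i :: r) (enum 'I_n.+1) -> F (gprod r) = f i) ->
  ((\sum_(t in T) F (t^-1 * gprod a)%g).*2 = #[gprod a]%g * \sum_i f i)%N.
Proof.
move=> pa F_conj F_f; have [n0|n_neq0] := eqVneq n 0%N.
  exact: sum_reflections_rank1.
have adj_sym : symmetric adj by move=> i j; rewrite /adj /= eq_sym Csym.
have adj_irr : irreflexive adj by move=> i; rewrite /adj /= eqxx.
have [hue hue_adj] := forest_2colour adj_sym adj_irr adj_forest.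
have hueP i j : i != j -> C i j != 0 -> hue i != hue j.
  by move=> nij Cij; apply: hue_adj; rewrite /adj /= nij.
have [||||mu [d [d_gt0 Cd]]] := @perron_frobenius R n C.
- exact: trmx_cartan.
- by move=> v; apply: cartan_posdef.
- by move=> i j /cartan_offdiag[].
- exact: conn.
have p_cox : perm_eq (cox_word hue) a.
  by apply: perm_trans (cox_word_perm hue) _; rewrite perm_sym.
have U_cox : uniq (cox_word hue) by rewrite (perm_uniq (cox_word_perm hue)) enum_uniq.
have [x Wx ->] := gprod_conj U_cox p_cox; rewrite -cox_gprod orderJ.
rewrite -(sum_reflections hueP d_gt0 Cd (colour_onto hueP n_neq0) F_conj F_f).
congr double; rewrite [LHS](reindex_inj (conjg_inj x)) /=.
apply: eq_big => t; first by rewrite -{1}(reflectionsJ Wx) memJ_conjg.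
by rewrite -conjVg -conjMg F_conj.
Qed.

End Connected.

(** * The recurrence for saturated chains *)

Lemma one_notin_reflections : 1%g \notin T.
Proof.
apply/reflectionsP => -[x [i [_ /esym/(canRL (mulgKV _))]]].
rewrite mul1g -{2}(mulg1 x) => /mulgI gi1.
by have := order_g i; rewrite gi1 order1.
Qed.

Lemma map_g_sub (r : seq gT) : {subset r <= S} -> exists a, map g a = r.
Proof.
elim: r => [|s r IHr] rS; first by exists [::].
have [|a <-] := IHr; first by move=> t rt; apply: rS; rewrite inE rt orbT.
have := rS s (mem_head _ _); rewrite imS => /imsetP[i _ ->].
by exists (i :: a).
Qed.

Lemma gprod_map a : gprod a = (\prod_(s <- map g a) s)%g.
Proof. by rewrite big_map. Qed.

Lemma perm_enum_uniq a : uniq a -> (forall i, i \in a) -> perm_eq a (enum 'I_n.+1).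
Proof.
move=> Ua a_all; apply: uniq_perm; rewrite ?enum_uniq // => i.
by rewrite a_all mem_enum.
Qed.

Lemma coxeter_element_gprod c : coxeter_element S c ->
  exists2 a, perm_eq a (enum 'I_n.+1) & c = gprod a.
Proof.
case=> r pr ->; have [|a def_r] := @map_g_sub r.
  by move=> s; rewrite (perm_mem pr) mem_enum.
exists a; last by rewrite gprod_map def_r.
apply: perm_enum_uniq; first by rewrite -(map_inj_uniq g_inj) def_r (perm_uniq pr) enum_uniq.
by move=> i; rewrite -(mem_map g_inj) def_r (perm_mem pr) mem_enum gS.
Qed.

Lemma coxeter_element_gprodD1 i c : coxeter_element (S :\ g i) c ->
  exists2 a, perm_eq (i :: a) (enum 'I_n.+1) & c = gprod a.
Proof.
case=> r pr ->; have [|a def_r] := @map_g_sub r.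
  by move=> s; rewrite (perm_mem pr) mem_enum => /setD1P[].
have mem_a j : (j \in a) = (j != i).
  by rewrite -(mem_map g_inj) def_r (perm_mem pr) mem_enum !inE gS andbT (inj_eq g_inj).
exists a; last by rewrite gprod_map def_r.
apply: perm_enum_uniq => [|j]; last by rewrite inE mem_a orbN.
by rewrite /= mem_a eqxx -(map_inj_uniq g_inj) def_r (perm_uniq pr) enum_uniq.
Qed.

Lemma SC_coxeter (k : nat) a : perm_eq a (enum 'I_n.+1) ->
  SC W S (gprod a) k = #|chain_set T n.+1 (gprod a) k|.
Proof.
move=> pa; apply: SC_chain_set one_notin_reflections _.
- have -> : n.+1 = size (map g a) by rewrite size_map (perm_size pa) size_enum_ord.
  rewrite gprod_map; apply: prod_mem_expg => _ /mapP[i _ ->]; exact: gT_refl.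
- move=> m; apply: coxeter_T_length; first by rewrite (perm_uniq pa) enum_uniq.
  by move=> i; rewrite (perm_mem pa) mem_enum.
Qed.

Lemma SC_parabolic (k : nat) i a : perm_eq (i :: a) (enum 'I_n.+1) ->
  SC <<S :\ g i>>%g (S :\ g i) (gprod a) k = #|chain_set T n (gprod a) k|.
Proof.
move=> pa; set J := S :\ g i; set TJ := reflections <<J>>%g J.
have U_ia : uniq (i :: a) by rewrite (perm_uniq pa) enum_uniq.
have ia_all j : j \in i :: a by rewrite (perm_mem pa) mem_enum.
have sz_a : size a = n by have := perm_size pa; rewrite size_enum_ord => -[].
have sJW : (<<J>> \subset W)%g.
  rewrite gen_subG; apply/subsetP => s /setD1P[_]; rewrite imS => /imsetP[j _ ->].
  exact: gW.
have sTJ : TJ \subset T.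
  apply/subsetP => _ /imset2P[s x /setD1P[_ Ss] Jx ->]; apply: imset2_f => //.
  exact: (subsetP sJW).
(* Preceded by [g i], a shorter word would factor a Coxeter element of [W] into fewer than [n.+1]
   reflections. *)
have TJ_mul m : (gprod a \in TJ ^+ m)%g -> (n <= m)%N.
  case/mem_expgP=> r [<- rT def_a]; rewrite -ltnS.
  apply: (coxeter_T_length U_ia ia_all); rewrite gprod_cons -def_a expgS.
  apply: mem_mulg (gT_refl i) _; apply: prod_mem_expg => t /rT; exact: (subsetP sTJ).
rewrite (SC_chain_set _ TJ_mul).
- congr #|pred_of_set _|; apply/esym/chain_set_sub_eq => // r sz_r rT def_a t rt_t.
  have t0 := parabolic_word U_ia ia_all rT sz_r def_a rt_t.
  have [x [j [Wx def_t tE]]] := rtP (rT t rt_t).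
  by rewrite def_t; apply: parabolic_root; rewrite // -tE.
- rewrite -[X in (TJ ^+ X)%g]sz_a -(size_map g a) gprod_map.
  apply: prod_mem_expg => _ /mapP[j aj ->]; rewrite -[g j]conjg1.
  apply: imset2_f; rewrite ?group1 // !inE gS andbT (inj_eq g_inj).
  by have /andP[ia _] := U_ia; apply: contraNneq ia => <-.
by apply: contra one_notin_reflections; apply: (subsetP sTJ).
Qed.

Lemma SC_recurrence (k : nat) c (c_ : gT -> gT) :
    (forall i j, connect [rel i j | C i j != 0] i j) ->
    coxeter_element S c -> (forall i, coxeter_element (S :\ g i) (c_ (g i))) ->
  ((SC W S c k.+1).*2
    = #[c]%g * \sum_i SC <<S :\ g i>>%g (S :\ g i) (c_ (g i)) k)%N.
Proof.
move=> conn /coxeter_element_gprod[a pa ->] cox_c.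
rewrite SC_coxeter // (card_chain_set_rec _ _ _ T_sub_W); last exact: reflectionsJ.
apply: (sum_coxeter_reflections conn (F := fun w => #|chain_set T n w k|)) => //.
  by move=> w x Wx; apply/card_chain_setJ/reflectionsJ.
move=> i r pr; have [b pb ->] := coxeter_element_gprodD1 (cox_c i).
rewrite SC_parabolic //.
have Ub : uniq b by have := perm_uniq pb; rewrite enum_uniq /= => /andP[].
(* Conjugacy holds for words in any subset of the generators, so the choice of Coxeter element in
   each parabolic subgroup is immaterial. *)
have [|x Wx ->] := gprod_conj Ub (_ : perm_eq b r).
  by rewrite -(perm_cons i); apply: perm_trans pb _; rewrite perm_sym.
by apply/card_chain_setJ/reflectionsJ.
Qed.

Lemma coxeter_order_eq c c' :
  coxeter_element S c -> coxeter_element S c' -> #[c]%g = #[c']%g.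
Proof.
case/coxeter_element_gprod=> a pa ->; case/coxeter_element_gprod=> b pb ->.
have Ua : uniq a by rewrite (perm_uniq pa) enum_uniq.
have [|x _ ->] := gprod_conj Ua (_ : perm_eq a b); last by rewrite orderJ.
by apply: perm_trans pa _; rewrite perm_sym.
Qed.

Lemma irreducible_connect : coxeter_irreducible S ->
  forall i j, connect [rel i j | C i j != 0] i j.
Proof.
case=> _ conn i j; have /connectP[p] := conn _ _ (gS i) (gS j).
elim: p i => [|s p IHp] i /=; first by move=> _ /g_inj->; apply: connect0.
case/andP=> /and3P[_ + m_gt2] pth; rewrite imS => /imsetP[k _ def_s] def_j.
apply: (connect_trans (y := k)); last by apply: IHp; rewrite -def_s.
apply: connect1 => /=; rewrite mxE oppr_eq0 -def_s gt_eqF //.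
have [_ _ _ [_ _ a_ge1]] := twice_cosP R (ltnW m_gt2).
exact: lt_le_trans (a_ge1 m_gt2).
Qed.

End CoxeterGroup.

Local Open Scope ring_scope.

Theorem corollary3p12 (gT : finGroupType) (W : {group gT}) (S : {set gT})
    (h k : nat) (c : gT) (c_ : gT -> gT)
    (coxWS : coxeter_system W S)
    (irrS : coxeter_irreducible S)
    (coxh : coxeter_number S h)
    (coxc : coxeter_element S c)
    (coxc_ : {in S, forall s, coxeter_element (S :\ s) (c_ s)})
    (k_gt0 : (0 < k)%N) :
  (SC W S c k)%:R =
    h%:R / 2 * \sum_(s in S) (SC <<S :\ s>>%g (S :\ s) (c_ s) k.-1)%:R :> rat.
Proof.
have /card_gt0P/prednK card_S : exists s, s \in S by apply/set0Pn; case: irrS.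
pose g i : gT := enum_val (cast_ord card_S i).
have g_inj : injective g by move=> i j /enum_val_inj/cast_ord_inj.
have imS : S = [set g i | i : 'I_(#|S|.-1).+1].
  apply/setP => s; apply/idP/imsetP => [Ss|[i _ ->]]; last exact: enum_valP.
  exists (cast_ord (esym card_S) (enum_rank_in Ss s)) => //.
  by rewrite /g cast_ordKV enum_rankK_in.
pose R : realType := Rdefinitions.R.
have [rho rhoM rho_g] := geometric_rep R coxWS g_inj imS.
have conn := irreducible_connect R g_inj imS irrS.
have cox_c i : coxeter_element (S :\ g i) (c_ (g i)).
  by apply: coxc_; rewrite imS imset_f.
have rec := SC_recurrence coxWS g_inj imS rhoM rho_g k.-1 conn coxc cox_c.
rewrite (prednK k_gt0) in rec.
have [c' coxc' h_eq] := coxh.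
have def_h := coxeter_order_eq coxWS g_inj imS rhoM rho_g coxc coxc'.
rewrite def_h -h_eq in rec.
have -> : \sum_(s in S) (SC <<S :\ s>>%g (S :\ s) (c_ s) k.-1)%:R
    = (\sum_i SC <<S :\ g i>>%g (S :\ g i) (c_ (g i)) k.-1)%:R :> rat.
  rewrite natr_sum {1}imS big_imset //= => i j _ _; exact: g_inj.
by rewrite mulrAC -natrM -rec -muln2 natrM mulfK.
Qed.
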